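(* The following decision problem is in the complexity class $\Pi^p_2$: given two finite, $\mathcal{X}$-labeled prime event structures $\mathcal{E}_1$ and $\mathcal{E}_2$, decide whether $\mathcal{L}(\mathcal{E}_1)\subseteq\mathcal{L}(\mathcal{E}_2)$.
   Context: A finite $\mathcal{X}$-labeled prime event structure (FLES) is a tuple $\mathcal{E}=\langle E,<,\#,h\rangle$ where $E$ is a finite set of events, $<$ is a strict partial order on $E$ (causality), $h:E\to\mathcal{X}$ is a labeling, and $\#$ is a symmetric, irreflexive conflict relation on $E$ closed under $<$ (if $e\#e'$ and $e'<e''$ then $e\#e''$). $\mathcal{X}$ contains a distinguished label $\varepsilon$ denoting the empty word. There is a special event $\bot$ with no event below it, $\bot<e$ for all other events $e$, and $h(\bot)=\varepsilon$. A configuration is a left-closed ($e\in C$, $e'<e$ imply $e'\in C$), conflict-free subset $C\subseteq E$; it is maximal if no configuration strictly contains it. A trace of $C$ lists every event of $C$ exactly once such that $e_i<e_j$ implies $i<j$. $T(\mathcal{E})$ is the union of traces of all maximal configurations and $\mathcal{L}(\mathcal{E})=\{h(t)\mid t\in T(\mathcal{E})\}$ with $h$ applied pointwise and $\varepsilon$ contributing nothing. $\Pi^p_2$ is the class of languages $L$ for which there is a polynomial-time decidable $L'$ with $x\in L\iff\forall y_1\exists y_2\,[\langle x,y_1,y_2\rangle\in L']$ (with polynomially bounded $y_1,y_2$). *)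

(* Defs.v *)
From mathcomp Require Import all_boot.
Set Implicit Arguments.
Unset Strict Implicit.
Unset Printing Implicit Defensive.

Inductive dir := DLeft | DStay | DRight.

(* States are 'I_(tm_k.+1); the start state is ord0.  tm_out q = Some b means
   that q is a halting state with answer b; None means non-halting. *)
Record TM := mkTM {
  tm_k : nat;
  tm_delta : 'I_tm_k.+1 -> option bool -> 'I_tm_k.+1 * option bool * dir;
  tm_out : 'I_tm_k.+1 -> option bool
}.

(* configuration: state, tape left of head (nearest cell first), head cell,
   tape right of head (nearest cell first); unspecified cells are blank. *)
Definition config (M : TM) :=
  ('I_(tm_k M).+1 * seq (option bool) * option bool * seq (option bool))%type.

Definition tm_step (M : TM) (c : config M) : config M :=
  let: (q, L, h, R) := c in
  let: (q', w, d) := tm_delta q h in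
  match d with
  | DStay => (q', L, w, R)
  | DLeft => match L with
             | [::] => (q', [::], None, w :: R)
             | a :: L' => (q', L', a, w :: R)
             end
  | DRight => match R with
              | [::] => (q', w :: L, None, [::])
              | a :: R' => (q', w :: L, a, R')
              end
  end.

Fixpoint tm_run (M : TM) (t : nat) (c : config M) : option bool :=
  let: (q, _, _, _) := c in
  match tm_out q with
  | Some b => Some b
  | None => if t is t'.+1 then tm_run t' (tm_step c) else None
  end.

Definition tm_init (M : TM) (x : seq bool) : config M :=
  match x with
  | [::] => (ord0, [::], None, [::])
  | b :: x' => (ord0, [::], Some b, map Some x')
  end.

Definition in_P (L : seq bool -> Prop) : Prop :=
  exists (M : TM) (c k : nat), forall x : seq bool,
    exists b : bool,
      tm_run (c * (size x) ^ k + c) (tm_init M x) = Some b /\ (b = true <-> L x).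

(* Self-delimiting pairing of bit strings: each bit b becomes [b; true], a
   separator is [false; false]. *)
Definition dbl (x : seq bool) : seq bool := flatten [seq [:: b; true] | b <- x].
Definition tup3 (x y z : seq bool) : seq bool :=
  dbl x ++ [:: false; false] ++ dbl y ++ [:: false; false] ++ z.

Definition in_Pi2 (L : seq bool -> Prop) : Prop :=
  exists (L' : seq bool -> Prop) (c k : nat),
    in_P L' /\
    forall x : seq bool,
      L x <-> (forall y1 : seq bool, size y1 <= c * (size x) ^ k + c ->
               exists y2 : seq bool, size y2 <= c * (size x) ^ k + c /\
                                     L' (tup3 x y1 y2)).

Definition eps : nat := 0.

Record fles := mkFLES {
  fl_n : nat;
  fl_lt : seq (nat * nat);       (* causality: (e, e') means e < e' *)
  fl_cf : seq (nat * nat);       (* conflict: (e, e') means e # e' *)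
  fl_lab : seq nat
}.

Section FLES.
Variable E : fles.

Definition ev (e : nat) : bool := e < fl_n E.
Definition lt_ev (e e' : nat) : bool := (e, e') \in fl_lt E.
Definition cf_ev (e e' : nat) : bool := (e, e') \in fl_cf E.
Definition lab (e : nat) : nat := nth eps (fl_lab E) e.

Definition wf_fles : Prop :=
  [/\ size (fl_lab E) = fl_n E,
      (forall e e', lt_ev e e' -> ev e /\ ev e') /\
      (forall e e', cf_ev e e' -> ev e /\ ev e'),
      (forall e, ~~ lt_ev e e) /\ (forall e1 e2 e3, lt_ev e1 e2 -> lt_ev e2 e3 -> lt_ev e1 e3),
      [/\ forall e e', cf_ev e e' -> cf_ev e' e,
          forall e, ~~ cf_ev e e &
          forall e e' e'', cf_ev e e' -> lt_ev e' e'' -> cf_ev e e''] &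
      exists bot, [/\ ev bot, (forall e, ~~ lt_ev e bot),
                      (forall e, ev e -> e != bot -> lt_ev bot e) & lab bot = eps]].

(* C (a finite set of events, given as a sequence) is a configuration *)
Definition is_conf (C : seq nat) : Prop :=
  [/\ (forall e, e \in C -> ev e),
      (forall e e', e \in C -> lt_ev e' e -> e' \in C) &
      (forall e e', e \in C -> e' \in C -> ~~ cf_ev e e')].

Definition is_max_conf (C : seq nat) : Prop :=
  is_conf C /\
  ~ (exists C', is_conf C' /\ {subset C <= C'} /\ exists e, e \in C' /\ e \notin C).

Definition is_trace_of (C t : seq nat) : Prop :=
  [/\ uniq t, (forall e, e \in t <-> e \in C) &
      (forall i j, i < size t -> j < size t ->
         lt_ev (nth 0 t i) (nth 0 t j) -> i < j)].

Definition traces (t : seq nat) : Prop :=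
  exists C, is_max_conf C /\ is_trace_of C t.

Definition hword (t : seq nat) : seq nat := [seq a <- map lab t | a != eps].

Definition lang (w : seq nat) : Prop := exists t, traces t /\ w = hword t.

End FLES.

Fixpoint bin_of_nat_fuel (f n : nat) : seq bool :=
  if f is f'.+1 then
    if n is 0 then [::] else odd n :: bin_of_nat_fuel f' n./2
  else [::].
Definition enc_nat (n : nat) : seq bool :=
  dbl (bin_of_nat_fuel n n) ++ [:: false; false].
Definition enc_list (T : Type) (f : T -> seq bool) (s : seq T) : seq bool :=
  enc_nat (size s) ++ flatten (map f s).
Definition enc_pair (p : nat * nat) : seq bool := enc_nat p.1 ++ enc_nat p.2.
Definition enc_fles (E : fles) : seq bool :=
  enc_nat (fl_n E) ++ enc_list enc_pair (fl_lt E) ++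
  enc_list enc_pair (fl_cf E) ++ enc_list enc_nat (fl_lab E).

Definition FLES_INCL (x : seq bool) : Prop :=
  exists E1 E2 : fles,
    [/\ wf_fles E1, wf_fles E2, x = enc_fles E1 ++ enc_fles E2 &
        forall w, lang E1 w -> lang E2 w].

(* Main.v *)
Require Import Defs.
From mathcomp Require Import all_boot zify.
From Stdlib Require Import FunctionalExtensionality Classical.
Set Implicit Arguments.
Unset Strict Implicit.
Unset Printing Implicit Defensive.

(* An event structure language inclusion fails exactly when some trace of a
   maximal configuration of the first structure has a word which no trace of
   the second one matches; so y1 ranges over the traces of E1 and y2 answers
   with a trace of E2.  Everything that remains to be verified is made first order:
   y2 also guesses the tables (token numbers, token values, equality of tokens)
   needed to parse x, and an order isomorphism between the visible positions of
   the two traces.  Maximality is first order as well, since a configuration is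
   maximal iff every event outside it is in conflict with an event inside it.

   The verifier is therefore a first-order formula with bounded quantifiers over
   positions of the input, whose atoms are input bits, sums and products.  Such
   a formula with K variables is evaluated in polynomial time by a machine that
   keeps its variables as marks on K tracks beside the input bits. *)

(** * Machines *)

(** The delicate points are the atoms and the adversarial [y1]. Table entries sit at index (j * M +
    p) * M + c, so the formula needs products, but a machine can only move, reset and compare marks.
    Addition is therefore iterated successor and multiplication iterated addition, where each
    intermediate value is found by search; terms whose value leaves the range of the variables need
    care throughout. Event numbers and list lengths are at most the input length, since each event
    has its own label token; labels are written in binary, may be exponentially large, and so are
    compared but never evaluated. When [y1] is not a trace the matrix must hold vacuously, while the
    parsing and the well-formedness of the input must be checked nevertheless; this is why they
    stand outside the quantifier over the length of the first trace. *)

Notation sym := (option bool).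
Notation tape := (nat -> option bool).

Definition write (T : tape) (p : nat) (a : sym) : tape :=
  fun x => if x == p then a else T x.

Definition moves (d : dir) (p p' : nat) : Prop :=
  match d with
  | DLeft => p = p'.+1
  | DStay => p' = p
  | DRight => p' = p.+1
  end.

Record mach := Mach {
  mst : finType;
  mstart : mst;
  mdelta : mst -> sym -> option mst * sym * dir
}.

(** A machine exits by a transition without successor state, which still writes and moves, so
    sequencing only has to redirect exits. As positions are natural numbers, no derivation passes
    the left end of the tape. *)
Inductive reach (M : mach) : mst M -> tape -> nat -> nat -> tape -> nat -> Prop :=
| reach_exit q T p w d p' :
    mdelta q (T p) = (None, w, d) -> moves d p p' ->
    reach q T p 1 (write T p w) p'
| reach_step q T p w d p' q' t T2 p2 :
    mdelta q (T p) = (Some q', w, d) -> moves d p p' ->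
    reach q' (write T p w) p' t T2 p2 -> reach q T p t.+1 T2 p2.

Definition runs (M : mach) (T : tape) (p t : nat) (T' : tape) (p' : nat) : Prop :=
  exists2 t', t' <= t & reach (mstart M) T p t' T' p'.

Lemma write_same T p : write T p (T p) = T.
Proof. by apply: functional_extensionality => x; rewrite /write; case: eqP => // ->. Qed.

Lemma runs_le M T p t1 t2 T' p' : t1 <= t2 -> runs M T p t1 T' p' -> runs M T p t2 T' p'.
Proof. by move=> le12 [t le_t r]; exists t => //; apply: leq_trans le12. Qed.

Definition act (w : sym -> sym) (d : dir) : mach :=
  @Mach unit tt (fun _ h => (None, w h, d)).

Definition seqm (M1 M2 : mach) : mach :=
  @Mach (mst M1 + mst M2)%type (inl (mstart M1)) (fun q h =>
    match q with
    | inl q1 => let: (o, w, d) := mdelta q1 h in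
                (Some (if o is Some q1' then inl q1' else inr (mstart M2)), w, d)
    | inr q2 => let: (o, w, d) := mdelta q2 h in (omap inr o, w, d)
    end).

Definition ifm (b : sym -> bool) (M1 M2 : mach) : mach :=
  @Mach (option (mst M1 + mst M2)) None (fun q h =>
    match q with
    | None => (Some (Some (if b h then inl (mstart M1) else inr (mstart M2))), h, DStay)
    | Some (inl q1) => let: (o, w, d) := mdelta q1 h in
                       (omap (Some \o inl) o, w, d)
    | Some (inr q2) => let: (o, w, d) := mdelta q2 h in
                       (omap (Some \o inr) o, w, d)
    end).

(** An exit [o = None] of the body is itself the test state, which closes the loop. *)
Definition whilem (b : sym -> bool) (M : mach) : mach :=
  @Mach (option (mst M)) None (fun q h =>
    match q with
    | None => (if b h then Some (Some (mstart M)) else None, h, DStay)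
    | Some q => let: (o, w, d) := mdelta q h in (Some o, w, d)
    end).

Lemma runs_act w d T p p' : moves d p p' ->
  runs (act w d) T p 1 (write T p (w (T p))) p'.
Proof. by move=> hd; exists 1 => //; apply: reach_exit hd. Qed.

Lemma runs_seq M1 M2 T p t1 T1 p1 t2 T2 p2 :
  runs M1 T p t1 T1 p1 -> runs M2 T1 p1 t2 T2 p2 ->
  runs (seqm M1 M2) T p (t1 + t2) T2 p2.
Proof.
move=> [s1 le1 r1] [s2 le2 r2]; exists (s1 + s2); first exact: leq_add.
have {}r2: @reach (seqm M1 M2) (inr (mstart M2)) T1 p1 s2 T2 p2.
  elim: r2 => [q U k w d k' e hd | q U k w d k' q' t U2 k2 e hd _ IH].
  - by apply: reach_exit hd => /=; rewrite e.
  - by apply: (reach_step _ hd IH) => /=; rewrite e.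
rewrite /=; elim: r1 r2 => [q U k w d k' e hd | q U k w d k' q' t U2 k2 e hd _ IH] r2.
- by apply: (reach_step _ hd r2) => /=; rewrite e.
- by apply: (reach_step _ hd (IH r2)) => /=; rewrite e.
Qed.

Lemma runs_if (b : sym -> bool) M1 M2 T p t T' p' :
  runs (if b (T p) then M1 else M2) T p t T' p' ->
  runs (ifm b M1 M2) T p t.+1 T' p'.
Proof.
move=> [s le_s r]; exists s.+1 => //.
apply: (@reach_step (ifm b M1 M2) None T p (T p) DStay p _ s) => //.
rewrite write_same; case: (b (T p)) r => /= r.
all: elim: r => {T p s le_s T' p'} [q U k w d k' e hd | q U k w d k' q' t0 U2 k2 e hd _ IH].
- by apply: reach_exit hd => /=; rewrite e.
- by apply: (reach_step _ hd IH) => /=; rewrite e.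
- by apply: reach_exit hd => /=; rewrite e.
- by apply: (reach_step _ hd IH) => /=; rewrite e.
Qed.

Lemma runs_while_end (b : sym -> bool) M T p : b (T p) = false -> runs (whilem b M) T p 1 T p.
Proof.
move=> bF; exists 1 => //; rewrite -{2}(write_same T p).
by apply: (@reach_exit (whilem b M) None T p (T p) DStay p); rewrite /= ?bF.
Qed.

Lemma runs_while_step (b : sym -> bool) M T p t1 T1 p1 t2 T2 p2 : b (T p) ->
  runs M T p t1 T1 p1 -> runs (whilem b M) T1 p1 t2 T2 p2 ->
  runs (whilem b M) T p (t1 + t2).+1 T2 p2.
Proof.
move=> bT [s1 le1 r1] [s2 le2 r2]; exists (s1 + s2).+1; first by rewrite ltnS leq_add.
apply: (@reach_step (whilem b M) None T p (T p) DStay p (Some (mstart M))) => //=.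
  by rewrite bT.
rewrite write_same; elim: r1 r2 => [q U k w d k' e hd | q U k w d k' q' t U2 k2 e hd _ IH] r2.
- by apply: (reach_step _ hd r2) => /=; rewrite e.
- by apply: (reach_step _ hd (IH r2)) => /=; rewrite e.
Qed.

(** * Translation into the Turing machines of the complexity classes *)

Section Compile.
Variable M : mach.

(** [inl (Some q)] simulates [q], [inl None] follows the exit and inspects the cell under the head,
    [inr b] has halted with answer [b]. *)
Let S : finType := (option (mst M) + bool)%type.
(** A Turing machine starts in [ord0], but [enum_rank] gives no control over which state has rank 0;
    an extra index 0 therefore stands for the start state. *)
Let dec (i : 'I_(#|{: S}|).+1) : S :=
  if unlift ord0 i is Some j then enum_val j else inl (Some (mstart M)).
Let enc (s : S) : 'I_(#|{: S}|).+1 := lift ord0 (enum_rank s).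
Let next (s : S) (h : sym) : S * sym * dir :=
  match s with
  | inl (Some q) => let: (o, w, d) := mdelta q h in (inl o, w, d)
  | inl None => (inr (isSome h), h, DStay)
  | inr b => (s, h, DStay)
  end.

Definition tm_of : TM :=
  mkTM (fun i h => let: (s, w, d) := next (dec i) h in (enc s, w, d))
       (fun i => if dec i is inr b then Some b else None).

Let encK s : dec (enc s) = s.
Proof. by rewrite /dec /enc liftK enum_rankK. Qed.

Definition represents (L : seq sym) (h : sym) (R : seq sym) (T : tape) (p : nat) : Prop :=
  [/\ h = T p, forall i, nth None R i = T (p + i.+1) &
      forall i, i < p -> nth None L i = T (p - i.+1)].

Lemma represents_step (q q' : 'I_(tm_k tm_of).+1) L h R T p p' w d : represents L h R T p ->
  tm_delta q h = (q', w, d) -> moves d p p' ->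
  exists L' h' R', tm_step (q, L, h, R) = (q', L', h', R') /\
                   represents L' h' R' (write T p w) p'.
Proof.
move=> [eh eR eL] e; rewrite /tm_step e /write; case: d e => /= _ ep.
- subst p; case: L eL => [|a L'] eL; do 3 eexists; split; try reflexivity; split => /=.
  + by have:= eL 0 isT; rewrite subn1 /= => <-; rewrite ltn_eqF.
  + by case=> [|i] /=; [rewrite addn1 eqxx | rewrite eR; case: eqP => [|_]; [lia | congr (T _); lia]].
  + move=> i lt_i; have := eL i.+1; rewrite ltnS => /(_ lt_i).
    by rewrite !nth_nil => ->; case: eqP => [|_]; [lia | congr (T _); lia].
  + by have:= eL 0 isT; rewrite subn1 /= => <-; rewrite ltn_eqF.
  + by case=> [|i] /=; [rewrite addn1 eqxx | rewrite eR; case: eqP => [|_]; [lia | congr (T _); lia]].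
  + move=> i lt_i; have /= -> := eL i.+1; last by [].
    by case: eqP => [|_]; [lia | congr (T _); lia].
- subst p'; do 3 eexists; split; first by reflexivity.
  split; first by rewrite eqxx.
  + by move=> i; rewrite eR; case: eqP => //; lia.
  + by move=> i lt_i; rewrite eL //; case: eqP => //; lia.
- subst p'; case: R eR => [|a R'] eR; do 3 eexists; split; try reflexivity; split => /=.
  + by have:= eR 0; rewrite addn1 => <-; rewrite gtn_eqF.
  + move=> i; have := eR i.+1.
    by rewrite !nth_nil => ->; case: eqP => [|_]; [lia | congr (T _); lia].
  + case=> [|i] lt_i /=; first by rewrite subn1 eqxx.
    by rewrite eL //; case: eqP => [|_]; [lia | congr (T _); lia].
  + by have:= eR 0; rewrite addn1 => <-; rewrite gtn_eqF.
  + move=> i; have /= -> := eR i.+1.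
    by case: eqP => [|_]; [lia | congr (T _); lia].
  + case=> [|i] lt_i /=; first by rewrite subn1 eqxx.
    by rewrite eL //; case: eqP => [|_]; [lia | congr (T _); lia].
Qed.

Lemma tm_runE t i L h R : @tm_run tm_of t.+1 (i, L, h, R) =
  if dec i is inr b then Some b else tm_run t (tm_step ((i, L, h, R) : config tm_of)).
Proof. by rewrite /=; case: (dec i). Qed.

Lemma tm_run_le (C : config tm_of) t t' b : t <= t' ->
  tm_run t C = Some b -> tm_run t' C = Some b.
Proof.
elim: t t' C => [|t IH] [|t'] [[[q L] h] R] //= le_t; case: (dec q) => //.
by move=> a; exact: IH.
Qed.

(** One of the two extra units of fuel pays for the step out of [inl None], where a nonblank cell
    under the head means yes. *)
Lemma tm_of_reach q T p t T' p' i L h R : reach q T p t T' p' -> dec i = inl (Some q) ->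
  represents L h R T p ->
  @tm_run tm_of t.+2 (i, L, h, R) = Some (isSome (T' p')).
Proof.
move=> r; elim: r i L h R => {q T p t T' p'} [q T p w d p' e hd | q T p w d p' q' t T2 p2 e hd _ IH] i L h R ei rep.
- have ed : @tm_delta tm_of i h = (enc (inl None), w, d).
    by case: rep => -> _ _; rewrite /= ei /= e.
  have [L' [h' [R' [est rep']]]] := represents_step rep ed hd.
  rewrite tm_runE ei est tm_runE encK /tm_step.
  case ed': (tm_delta _ _) => [[k w'] d'].
  have [ek _ _] : [/\ k = enc (inr (isSome h')), w' = h' & d' = DStay].
    by move: ed'; rewrite /= encK => -[<- <- <-].
  have ek2 : dec k = inr (isSome (write T p w p')) by rewrite ek encK; case: rep' => ->.
  by move: ek2; clear; case: d'; [case: L' | | case: R'] => [|? ?|| |? ?] ek2 /=; rewrite ek2.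
- have ed : @tm_delta tm_of i h = (enc (inl (Some q')), w, d).
    by case: rep => -> _ _; rewrite /= ei /= e.
  have [L' [h' [R' [est rep']]]] := represents_step rep ed hd.
  rewrite tm_runE ei est; apply: IH rep'; exact: encK.
Qed.

(** Cell 0 is blank and the input starts at cell 1; so [home], the cell after the input, has a left
    neighbour even for the empty input, as the loops below require. *)
Lemma tm_of_runs x t T' p' :
  runs M (fun p => if p is p'.+1 then nth None (map Some x) p' else None) 1 t T' p' ->
  tm_run t.+2 (tm_init tm_of x) = Some (isSome (T' p')).
Proof.
move=> [s le_s r]; apply: (@tm_run_le _ s.+2) => //.
have ei : dec ord0 = inl (Some (mstart M)) by rewrite /dec unlift_none.
case: x r => [|b x] r; apply: (tm_of_reach r ei); split=> //= -[|i] //=.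
Qed.

End Compile.

(** * Variables as marks on the tape *)

(** The base [n.+1] makes powers monotone in the exponent, also at n = 0, so that sums and products
    of bounds are immediate. *)
Definition pbound (f : nat -> nat) : Prop := exists C k, forall n, f n <= C * n.+1 ^ k.

Lemma pbound_const c : pbound (fun=> c).
Proof. by exists c, 0 => n; rewrite muln1. Qed.

Lemma pbound_id : pbound id.
Proof. by exists 1, 1 => n; rewrite mul1n expn1. Qed.

Lemma pboundD f g : pbound f -> pbound g -> pbound (fun n => f n + g n).
Proof.
move=> [C [k hf]] [D [l hg]]; exists (C + D), (k + l) => n.
rewrite mulnDl leq_add // (leq_trans (hf n), leq_trans (hg n)) // leq_mul2l.
  by rewrite leq_pexp2l ?leq_addr ?orbT.
by rewrite leq_pexp2l ?leq_addl ?orbT.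
Qed.

Lemma pboundM f g : pbound f -> pbound g -> pbound (fun n => f n * g n).
Proof.
move=> [C [k hf]] [D [l hg]]; exists (C * D), (k + l) => n.
by rewrite expnD mulnACA leq_mul.
Qed.

Ltac poly := repeat first [exact: pbound_id | exact: pbound_const | assumption
  | apply: pboundD | apply: pboundM | apply: (pboundD (pbound_const 1))].

Definition still : mach := act id DStay.
Definition left1 : mach := act id DLeft.
Definition right1 : mach := act id DRight.
Definition moveR n := iter n (seqm right1) still.
Definition moveL n := iter n (seqm left1) still.
Definition scanL := whilem isSome left1.
Definition scanR := whilem isSome right1.

Lemma runs_still T p : runs still T p 1 T p.
Proof. by rewrite -{2}(write_same T p); apply: runs_act. Qed.

Lemma runs_left1 T p : runs left1 T p.+1 1 T p.
Proof. by rewrite -{2}(write_same T p.+1); apply: runs_act. Qed.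

Lemma runs_right1 T p : runs right1 T p 1 T p.+1.
Proof. by rewrite -{2}(write_same T p); apply: runs_act. Qed.

Lemma runs_moveR n T p : runs (moveR n) T p n.+1 T (p + n).
Proof.
elim: n p => [|n IH] p; first by rewrite addn0; apply: runs_still.
by rewrite -addSnnS; apply: (@runs_seq _ _ _ _ 1 _ _ _ _ _ (runs_right1 _ _) (IH _)).
Qed.

Lemma runs_moveL n T p : runs (moveL n) T (p + n) n.+1 T p.
Proof.
elim: n p => [|n IH] p; first by rewrite addn0; apply: runs_still.
by rewrite addnS; apply: (@runs_seq _ _ _ _ 1 _ _ _ _ _ (runs_left1 _ _) (IH _)).
Qed.

Lemma runs_scanL T p n : T p = None -> (forall i, i < n -> isSome (T (p + i.+1))) ->
  runs scanL T (p + n) (n.*2.+1) T p.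
Proof.
move=> eN; elim: n => [|n IH] hS; first by rewrite addn0; apply: runs_while_end; rewrite eN.
have -> : n.+1.*2.+1 = (1 + n.*2.+1).+1 by lia.
apply: (runs_while_step _ _ (IH _)) => [| |i lt_i]; last by apply: hS; apply: ltnW.
- exact: hS.
- by rewrite addnS; apply: runs_left1.
Qed.

Lemma runs_scanR T p n : T (p + n) = None -> (forall i, i < n -> isSome (T (p + i))) ->
  runs scanR T p (n.*2.+1) T (p + n).
Proof.
elim: n p => [|n IH] p eN hS.
  by rewrite addn0 in eN *; apply: runs_while_end; rewrite eN.
rewrite -addSnnS; have -> : n.+1.*2.+1 = (1 + n.*2.+1).+1 by lia.
apply: (runs_while_step _ _ (IH _ _ _)) => [| ||i lt_i].
- by have := hS 0 isT; rewrite addn0.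
- exact: runs_right1.
- by rewrite addSnnS.
- by rewrite addSnnS; apply: hS.
Qed.

Definition setv (v : nat -> nat) (j a : nat) : nat -> nat :=
  fun x => if x == j then a else v x.

Section Marks.
Variable K : nat.
Implicit Types (z : seq bool) (v : nat -> nat).

Definition home z := (size z).+1.
Definition cellpos z i r := (size z).+2 + (i * K.+1 + r).

(* [v j = (size z).+1] encodes the absence of the mark of variable [j]. *)
Definition content z v i r : bool := if r is j.+1 then v j == i else nth false z i.

(** With bits as the only symbols besides the blank, the tracks are interleaved into blocks of
    [K.+1] cells, one block for each position up to and including [size z]. No block cell is blank,
    so a scan to the left ends at [home]. *)
Definition mtape z v : tape := fun p =>
  if (size z).+2 <= p < (size z).+2 + (size z).+1 * K.+1 then
    Some (content z v ((p - (size z).+2) %/ K.+1) ((p - (size z).+2) %% K.+1))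
  else None.

Lemma mtape_home z v : mtape z v (home z) = None.
Proof. by rewrite /mtape /home ltnn. Qed.

Lemma cell_lt n i r : i <= n -> r <= K -> i * K.+1 + r < n.+1 * K.+1.
Proof. by move=> le_i le_r; nia. Qed.

Lemma mtape_cell z v i r : i <= size z -> r <= K ->
  mtape z v (cellpos z i r) = Some (content z v i r).
Proof.
move=> le_i le_r; rewrite /mtape /cellpos leq_addr ltn_add2l cell_lt //=.
by rewrite addKn divnMDl // modnMDl divn_small // modn_small // addn0.
Qed.

Lemma mtape_some z v i : i < (size z).+1 * K.+1 -> isSome (mtape z v (home z + i.+1)).
Proof. by move=> lt_i; rewrite /home (_ : _ + _ = (size z).+2 + i) /mtape ?leq_addr ?ltn_add2l ?lt_i //; lia. Qed.

Lemma mtape_out z v i r : size z < i -> mtape z v (cellpos z i r) = None.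
Proof.
move=> lt_i; rewrite /mtape /cellpos ltn_add2l.
by rewrite [X in _ && X](_ : _ = false) ?andbF //; apply/negbTE; rewrite -leqNgt; nia.
Qed.

Lemma write_mark z v j i b : i <= size z -> j < K ->
  (forall k, k != i -> k <= size z -> (v j == k) = false) ->
  write (mtape z v) (cellpos z i j.+1) (Some b) =
  mtape z (setv v j (if b then i else (size z).+1)).
Proof.
move=> le_i lt_j hv; apply: functional_extensionality => p; rewrite /write.
case: eqP => [->|np].
  by rewrite mtape_cell //= /setv eqxx; case: b; rewrite ?eqxx // eqn_leq leqNgt ltnS le_i.
rewrite /mtape; case: ifP => // /andP[le_p lt_p]; congr Some.
have [o eo] : exists o, p = (size z).+2 + o by exists (p - (size z).+2); lia.
subst p; rewrite addKn /content; move: lt_p; rewrite ltn_add2l => lt_o.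
case er: (o %% K.+1) => [|j'] //; rewrite /setv; case: (j' =P j) => // ej; subst j'.
have lt_d : o %/ K.+1 <= size z by rewrite -ltnS ltn_divLR.
have nd : o %/ K.+1 != i.
  by apply: contra_notN np => /eqP <-; rewrite /cellpos -er -divn_eq.
by rewrite hv //; case: b; apply/esym/negbTE; lia.
Qed.

Definition go_home := scanL.

Lemma runs_go_home z v i r : i <= size z -> r <= K ->
  runs go_home (mtape z v) (cellpos z i r) (4 * (size z).+2 * K.+2) (mtape z v) (home z).
Proof.
move=> le_i le_r; have := cell_lt le_i le_r => lt_c.
have -> : cellpos z i r = home z + (i * K.+1 + r).+1 by rewrite /cellpos /home; lia.
apply: (@runs_le _ _ _ ((i * K.+1 + r).+1.*2.+1)); first by nia.
by apply: runs_scanL => [|k lt_k]; rewrite ?mtape_home // mtape_some //; lia.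
Qed.

Definition goto j := seqm (moveR j.+2) (whilem (pred1 (Some false)) (moveR K.+1)).

Lemma runs_goto z v j : j < K -> v j <= size z ->
  runs (goto j) (mtape z v) (home z) (4 * (size z).+2 * K.+2) (mtape z v) (cellpos z (v j) j.+1).
Proof.
move=> lt_j le_v.
apply: (@runs_le _ _ _ (j.+3 + (v j * K.+3).+1)).
  have : v j * K.+3 <= size z * K.+3 by rewrite leq_mul2r le_v orbT.
  by move: (size z) (v j * _) => n x; nia.
apply: runs_seq (runs_moveR _ _ _) _.
have -> : home z + j.+2 = cellpos z 0 j.+1 by rewrite /home /cellpos; lia.
suff H n i : v j = i + n -> runs (whilem (pred1 (Some false)) (moveR K.+1))
  (mtape z v) (cellpos z i j.+1) (n * K.+3).+1 (mtape z v) (cellpos z (v j) j.+1).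
  by apply: H; rewrite add0n.
elim: n i => [|n IH] i ev.
  rewrite ev addn0 mul0n; apply: runs_while_end.
  by rewrite mtape_cell //= ?ev ?addn0 ?eqxx //; lia.
have -> : (n.+1 * K.+3).+1 = (K.+2 + (n * K.+3).+1).+1 by lia.
apply: (runs_while_step _ _ (IH i.+1 _)); last by lia.
  have [nvi le_i] : (v j == i) = false /\ i <= size z by lia.
  by rewrite mtape_cell /= ?nvi.
have -> : cellpos z i.+1 j.+1 = cellpos z i j.+1 + K.+1 by rewrite /cellpos; lia.
exact: runs_moveR.
Qed.

Definition shift j k := if j <= k then moveR (k - j) else moveL (j - k).

Lemma runs_shift z i j k T : j <= K -> k <= K ->
  runs (shift j k) T (cellpos z i j) K.+1 T (cellpos z i k).
Proof.
move=> le_j le_k; rewrite /shift; case: (leqP j k) => le_jk.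
  have -> : cellpos z i k = cellpos z i j + (k - j) by rewrite /cellpos; lia.
  by apply: runs_le (runs_moveR _ _ _); lia.
have -> : cellpos z i j = cellpos z i k + (j - k) by rewrite /cellpos; lia.
by apply: runs_le (runs_moveL _ _ _); lia.
Qed.

Definition put b := act (fun=> Some b) DStay.

Lemma runs_put b T p : runs (put b) T p 1 (write T p (Some b)) p.
Proof. exact: runs_act. Qed.

(* A decision machine starts at [home] and answers by halting on [home] (no)
   or one cell to its right (yes). *)
Definition answer b := if b then seqm go_home right1 else go_home.

Definition unit_time n := 4 * n.+2 * K.+2.

Lemma runs_answer b z v i r : i <= size z -> r <= K ->
  runs (answer b) (mtape z v) (cellpos z i r) (unit_time (size z)).+1 (mtape z v) (home z + b).
Proof.
move=> le_i le_r; case: b; last first.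
  by rewrite addn0; apply: runs_le (runs_go_home _ _ _) => //; rewrite leqnSn.
rewrite -addn1; apply: runs_seq; first exact: runs_go_home.
by rewrite addn1; apply: runs_right1.
Qed.

(** Column 0 of a block holds the input bit and column [k.+1] the mark of variable [k], so this one
    machine serves both for input atoms and for equality of variables. *)
Definition readm j k := seqm (goto j) (seqm (shift j.+1 k)
  (ifm (pred1 (Some true)) (answer true) (answer false))).

Lemma runs_readm z v j k : j < K -> k <= K -> v j <= size z ->
  runs (readm j k) (mtape z v) (home z) (unit_time (size z) * 4)
    (mtape z v) (home z + content z v (v j) k).
Proof.
move=> lt_j le_k le_v.
apply: (@runs_le _ _ _ (unit_time (size z) + (K.+1 + (unit_time (size z)).+2))).
  by rewrite /unit_time; nia.
apply: runs_seq (runs_goto lt_j le_v) _; apply: runs_seq; first exact: runs_shift.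
apply: runs_if; rewrite mtape_cell //.
by case: (content _ _ _ _); apply: runs_answer.
Qed.

Lemma setv_setv v j a b : setv (setv v j a) j b = setv v j b.
Proof. by apply: functional_extensionality => x; rewrite /setv; case: eqP. Qed.

Lemma write_unmark z v j : j < K -> v j <= size z ->
  write (mtape z v) (cellpos z (v j) j.+1) (Some false) = mtape z (setv v j (size z).+1).
Proof.
by move=> lt_j le_v; rewrite write_mark // => k nk _; rewrite eq_sym; apply: negbTE.
Qed.

Lemma write_remark z v j i : j < K -> i <= size z ->
  write (mtape z (setv v j (size z).+1)) (cellpos z i j.+1) (Some true) = mtape z (setv v j i).
Proof.
move=> lt_j le_i; rewrite write_mark //= ?setv_setv // => k nk le_k.
by rewrite /setv eqxx; apply/negbTE; lia.
Qed.

(** A blank one block further reveals that the variable was at its maximum [size z]; the mark is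
    then put back and the answer is no. *)
Definition incm j := seqm (goto j) (seqm (put false) (seqm (moveR K.+1)
  (ifm isSome (seqm (put true) (answer true))
              (seqm (moveL K.+1) (seqm (put true) (answer false)))))).

Lemma runs_incm z v j : j < K -> v j <= size z ->
  runs (incm j) (mtape z v) (home z) (unit_time (size z) * 4)
    (mtape z (setv v j (if v j < size z then (v j).+1 else v j))) (home z + (v j < size z)).
Proof.
move=> lt_j le_v.
apply: (@runs_le _ _ _ (unit_time (size z) + (1 + (K.+2 + (K.+2 + (1 + (unit_time (size z)).+1)).+1)))).
  by rewrite /unit_time; nia.
apply: runs_seq (runs_goto lt_j le_v) _; apply: runs_seq (runs_put _ _ _) _.
rewrite write_unmark //; apply: runs_seq (runs_moveR _ _ _) _; apply: runs_if.
have -> : cellpos z (v j) j.+1 + K.+1 = cellpos z (v j).+1 j.+1 by rewrite /cellpos; lia.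
case: (ltnP (v j) (size z)) => hv.
  rewrite mtape_cell //=; apply: (@runs_le _ _ _ (1 + (unit_time (size z)).+1)); first by lia.
  apply: runs_seq (runs_put _ _ _) _; rewrite write_remark //.
  exact: (runs_answer true).
rewrite mtape_out //=.
apply: (@runs_seq _ _ _ _ K.+2 (mtape z (setv v j (size z).+1)) (cellpos z (v j) j.+1)).
  have -> : cellpos z (v j).+1 j.+1 = cellpos z (v j) j.+1 + K.+1 by rewrite /cellpos; lia.
  exact: runs_moveL.
apply: runs_seq (runs_put _ _ _) _; rewrite write_remark //.
exact: (runs_answer false).
Qed.

(** [M] has to find its target in column [r] while the mark of [j] is missing, which is why
    [runs_copym] requires [j] and [k] to differ. *)
Definition setm j (M : mach) (r : nat) := seqm (goto j) (seqm (put false) (seqm go_home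
  (seqm M (seqm (shift r j.+1) (seqm (put true) (answer false)))))).

Lemma runs_setm z v j M r i : j < K -> v j <= size z -> i <= size z -> r <= K ->
  let w := setv v j (size z).+1 in
  runs M (mtape z w) (home z) (unit_time (size z)) (mtape z w) (cellpos z i r) ->
  runs (setm j M r) (mtape z v) (home z) (unit_time (size z) * 6) (mtape z (setv v j i)) (home z).
Proof.
move=> lt_j le_v le_i le_r w rM.
apply: (@runs_le _ _ _ (unit_time (size z) + (1 + (unit_time (size z) + (unit_time (size z) +
  (K.+1 + (1 + (unit_time (size z)).+1))))))).
  by rewrite /unit_time; nia.
apply: runs_seq (runs_goto lt_j le_v) _; apply: runs_seq (runs_put _ _ _) _.
rewrite write_unmark //; apply: runs_seq; first exact: runs_go_home.
apply: runs_seq rM _; apply: runs_seq; first exact: runs_shift.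
apply: runs_seq (runs_put _ _ _) _; rewrite write_remark //.
by rewrite -[home z]addn0; apply: (runs_answer false).
Qed.

Definition zerom j := setm j (moveR 1) 0.
Definition copym j k := setm j (goto k) k.+1.

Lemma runs_zerom z v j : j < K -> v j <= size z ->
  runs (zerom j) (mtape z v) (home z) (unit_time (size z) * 6) (mtape z (setv v j 0)) (home z).
Proof.
move=> lt_j le_v; apply: runs_setm => //.
have -> : cellpos z 0 0 = home z + 1 by rewrite /cellpos /home; lia.
by apply: runs_le (runs_moveR _ _ _); rewrite /unit_time; nia.
Qed.

Lemma runs_copym z v j k : j < K -> k < K -> j != k -> v j <= size z -> v k <= size z ->
  runs (copym j k) (mtape z v) (home z) (unit_time (size z) * 6) (mtape z (setv v j (v k))) (home z).
Proof.
move=> lt_j lt_k njk le_v le_v'; apply: runs_setm => //.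
set w := setv _ _ _; have ew : w k = v k by rewrite /w /setv eq_sym (negbTE njk).
by rewrite -ew; apply: runs_goto; rewrite ?ew.
Qed.

End Marks.

(** * Preparing the tape *)

Section Prepare.
Variable K : nat.
Variable z : seq bool.
Let n := size z.

(* The first [i] input bits have been erased and the first [len] cells of the
   block area written. *)
Definition stage i len : tape := fun p =>
  if p <= n then (if i < p then Some (nth false z p.-1) else None)
  else if n.+2 <= p < n.+2 + len then
    Some (content z (fun=> n.+1) ((p - n.+2) %/ K.+1) ((p - n.+2) %% K.+1))
  else None.

Lemma stage_home i len : stage i len (home z) = None.
Proof. by rewrite /stage /home ltnn ltnn. Qed.

Lemma stage_raw i len p : p <= n -> stage i len p = if i < p then Some (nth false z p.-1) else None.
Proof. by rewrite /stage => ->. Qed.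

Lemma stage_block i len o : isSome (stage i len (home z + o.+1)) = (o < len).
Proof.
rewrite /stage /home -/n (_ : n.+1 + o.+1 = n.+2 + o); last by lia.
rewrite ifF; last by lia.
by rewrite leq_addr ltn_add2l; case: (o < len).
Qed.

Lemma stage_erase i len : i < n -> write (stage i len) i.+1 None = stage i.+1 len.
Proof.
move=> lt_i; apply: functional_extensionality => p; rewrite /write /stage.
case: eqP => [->|np]; first by rewrite lt_i ltnn.
case: (leqP p n) => // le_p; congr (if _ then _ else _); lia.
Qed.

Lemma stage_append i len : write (stage i len) (home z + len.+1)
  (Some (content z (fun=> n.+1) (len %/ K.+1) (len %% K.+1))) = stage i len.+1.
Proof.
apply: functional_extensionality => p; rewrite /write /stage /home -/n.
case: eqP => [->|np].
  have -> : n.+1 + len.+1 = n.+2 + len by lia.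
  rewrite addKn ifF; last by lia.
  by rewrite ifT //; lia.
by case: (leqP p n) => // le_p; congr (if _ then _ else _); lia.
Qed.

Definition wr b := act (fun=> Some b) DRight.

Lemma runs_wr b T p : runs (wr b) T p 1 (write T p (Some b)) p.+1.
Proof. exact: runs_act. Qed.

Definition appendm b := seqm right1 (seqm scanR (seqm (wr b)
  (seqm (iter K (seqm (wr false)) left1) scanL))).

Definition append_time := 10 * n.+2 * K.+2.

Lemma runs_appendm i k : k <= n ->
  runs (appendm (nth false z k)) (stage i (k * K.+1)) (home z) append_time
       (stage i (k.+1 * K.+1)) (home z).
Proof.
move=> le_k.
have le_kK : k * K.+1 <= n * K.+1 by rewrite leq_mul2r le_k.
apply: (@runs_le _ _ _ (1 + ((k * K.+1).*2.+1 + (1 + (K.+1 + (k.+1 * K.+1).*2.+1))))).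
  by rewrite /append_time; nia.
apply: runs_seq (runs_right1 _ _) _; apply: runs_seq.
  apply: (@runs_scanR _ _ (k * K.+1)) => [|o lt_o].
    by rewrite addSnnS; apply/eqP; case: (stage _ _ _) (stage_block i (k * K.+1) (k * K.+1)); rewrite ?ltnn.
  by rewrite addSnnS stage_block.
rewrite addSnnS.
have {1}-> : nth false z k =
    content z (fun=> n.+1) ((k * K.+1) %/ K.+1) ((k * K.+1) %% K.+1).
  by rewrite mulnK // modnMl.
apply: runs_seq (runs_wr _ _ _) _; rewrite stage_append.
have -> : (home z + (k * K.+1).+1).+1 = home z + (k * K.+1 + 0).+2 by lia.
have H r : r <= K -> runs (iter r (seqm (wr false)) left1) (stage i (k * K.+1 + (K - r)).+1)
    (home z + (k * K.+1 + (K - r)).+2) r.+1 (stage i (k.+1 * K.+1)) (home z + k.+1 * K.+1).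
  elim: r => [|r IH] le_r.
    have -> : (k * K.+1 + (K - 0)).+1 = k.+1 * K.+1 by lia.
    by rewrite addnS; apply: runs_left1.
  rewrite iterS; apply: (@runs_seq (wr _) _ _ _ 1 _ _ r.+1 _ _ (runs_wr _ _ _)).
  have er : K - r = (K - r.+1).+1 by lia.
  have ef : false = content z (fun=> n.+1) ((k * K.+1 + (K - r.+1)).+1 %/ K.+1)
                              ((k * K.+1 + (K - r.+1)).+1 %% K.+1).
    rewrite -addnS -er divnMDl // modnMDl divn_small ?modn_small ?ltnS ?leq_subr //.
    by rewrite addn0 /content er; apply/esym/negbTE; lia.
  rewrite [X in write _ _ (Some X)]ef stage_append -[(home z + _).+1]addnS.
  by rewrite (_ : (_ + (K - r.+1)).+2 = (k * K.+1 + (K - r)).+1);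
    [apply: IH; apply: ltnW | lia].
apply: runs_seq.
  by have := H K (leqnn _); rewrite subnn addn0 => {}H; apply: H.
apply: runs_scanL => [|o lt_o]; first exact: stage_home.
by rewrite stage_block.
Qed.

(** The bit is remembered in the finite control, and the hole left by erasing it is where the scan
    back to the left stops. *)
Definition copy1 b := seqm (act (fun=> None) DRight) (seqm scanR (seqm (appendm b)
  (seqm left1 (seqm scanL right1)))).
Definition copyz := whilem isSome (ifm (pred1 (Some true)) (copy1 true) (copy1 false)).

Lemma runs_copyz : runs copyz (stage 0 0) 1 (n.+1 * (append_time + 5 * n.+2))
  (stage n (n * K.+1)) (home z).
Proof.
suff H r : r <= n -> runs copyz (stage (n - r) ((n - r) * K.+1)) (n - r).+1
    (r.+1 * (append_time + 5 * n.+2)) (stage n (n * K.+1)) (home z).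
  by have := H n (leqnn _); rewrite subnn.
elim: r => [|r IH] le_r.
  rewrite subn0; apply: (@runs_le _ _ _ 1); first by nia.
  by apply: runs_while_end; rewrite stage_home.
set i := n - r.+1; have ei : n - r = i.+1 by lia.
have lt_i : i < n by lia.
apply: (@runs_le _ _ _ ((append_time + 5 * n.+2).-1 + (r.+1 * (append_time + 5 * n.+2))).+1).
  by rewrite mulSn; lia.
apply: (runs_while_step _ _ (IH (ltnW le_r))); first by rewrite stage_raw // ltnSn.
rewrite ei.
have rw : runs (copy1 (nth false z i)) (stage i (i * K.+1)) i.+1
   (append_time + 4 * n.+2) (stage i.+1 (i.+1 * K.+1)) i.+2.
  apply: (@runs_le _ _ _ (1 + ((n - i.+1).*2.+1 + (append_time + (1 + ((n - i.+1).*2.+1 + 1)))))).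
    by lia.
  apply: runs_seq; first exact: runs_act.
  rewrite stage_erase //.
  have eh : home z = i.+2 + (n - i.+1) by rewrite /home -/n; lia.
  have eh' : n = i.+1 + (n - i.+1) by lia.
  apply: runs_seq.
    apply: (@runs_scanR _ _ (n - i.+1)) => [|o lt_o]; first by rewrite -eh stage_home.
    by rewrite stage_raw ?ifT //; lia.
  rewrite -eh; apply: runs_seq; first by apply: runs_appendm; apply: ltnW.
  apply: runs_seq (runs_left1 _ _) _; apply: runs_seq (runs_right1 _ _).
  have := @runs_scanL (stage i.+1 (i.+1 * K.+1)) i.+1 (n - i.+1).
  rewrite -eh'; apply => [|o lt_o]; first by rewrite stage_raw // ltnn.
  by rewrite stage_raw ?ifT //; lia.
apply: (@runs_le _ _ _ (append_time + 4 * n.+2).+1); first by lia.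
apply: runs_if; rewrite stage_raw // ltnSn /=.
by case: (nth _ _ _) rw.
Qed.

Definition initm := seqm (moveR 2) (seqm (iter K (seqm (wr true)) left1) go_home).

Definition vars0 : nat -> nat := fun x => if x < K then 0 else n.+1.

Lemma runs_initm : runs initm (mtape K z (fun=> n.+1)) (home z) (2 * unit_time K n)
  (mtape K z vars0) (home z).
Proof.
apply: (@runs_le _ _ _ (3 + (K.+1 + unit_time K n))); first by rewrite /unit_time; nia.
apply: runs_seq (runs_moveR _ _ _) _.
have -> : home z + 2 = cellpos K z 0 1 by rewrite /home /cellpos; lia.
pose w r : nat -> nat := fun x => if x < r then 0 else n.+1.
have H r : r <= K -> runs (iter r (seqm (wr true)) left1) (mtape K z (w (K - r)))
    (cellpos K z 0 (K - r).+1) r.+1 (mtape K z vars0) (cellpos K z 0 K).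
  elim: r => [|r IH] le_r.
    rewrite subn0 /cellpos !addnS; exact: runs_left1.
  apply: (@runs_seq _ _ _ _ 1 _ _ r.+1 _ _ (runs_wr _ _ _)).
  have er : K - r = (K - r.+1).+1 by lia.
  rewrite write_mark; [|lia|lia|].
    have -> : setv (w (K - r.+1)) (K - r.+1) 0 = w (K - r).
      apply: functional_extensionality => x; rewrite /setv /w.
      by case: (x =P _) => ?; case: (ltnP x (K - r.+1)) => ?; case: (ltnP x (K - r)) => ?; lia.
    have -> : (cellpos K z 0 (K - r.+1).+1).+1 = cellpos K z 0 (K - r).+1.
      by rewrite /cellpos er; lia.
    by apply: IH; apply: ltnW.
  by move=> k _ le_k; rewrite /w ltnn; apply/negbTE; move: le_k; rewrite -/n; lia.
apply: runs_seq.
  have := H K (leqnn _); rewrite subnn; have -> : w 0 = fun=> n.+1 by []; exact.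
by apply: runs_go_home.
Qed.

(** The extra block is that of position [size z], a legal value of the variables that carries no
    input bit. *)
Definition prep := seqm copyz (seqm (appendm false) initm).

Definition prep_time := n.+1 * (append_time + 5 * n.+2) + (append_time + 2 * unit_time K n).

Lemma runs_prep :
  runs prep (fun p => if p is p'.+1 then nth None (map Some z) p' else None) 1
       prep_time (mtape K z vars0) (home z).
Proof.
have -> : (fun p => if p is p'.+1 then nth None (map Some z) p' else None) = stage 0 0.
  apply: functional_extensionality => -[|p] //; rewrite /stage /=.
  case: ltnP => lt_p; first by rewrite (nth_map false).
  by rewrite nth_default ?size_map // ifF //; lia.
apply: runs_seq runs_copyz _; apply: runs_seq runs_initm.
have -> : mtape K z (fun=> n.+1) = stage n (n.+1 * K.+1).
  apply: functional_extensionality => p; rewrite /mtape /stage -/n.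
  by case: (leqP p n) => //= le_p; rewrite ifF //; lia.
by have := @runs_appendm n n (leqnn _); rewrite nth_default.
Qed.

End Prepare.

(** * Decision machines *)

Section Decisions.
Variable K : nat.
Implicit Types (z : seq bool) (v : nat -> nat).

Definition bounded z v := forall i, i < K -> v i <= size z.
Definition agree d v v' := forall i, i < d -> v' i = v i.

Lemma agree_trans d v1 v2 v3 : agree d v1 v2 -> agree d v2 v3 -> agree d v1 v3.
Proof. by move=> h1 h2 i lt_i; rewrite h2 // h1. Qed.

Lemma agree_le d d' v1 v2 : d <= d' -> agree d' v1 v2 -> agree d v1 v2.
Proof. by move=> le_d h i lt_i; apply: h; apply: leq_trans le_d. Qed.

Lemma agree_setv d j a v : d <= j -> agree d v (setv v j a).
Proof. by move=> le_j i lt_i; rewrite /setv; case: eqP => // ei; lia. Qed.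

Lemma bounded_setv z v j a : bounded z v -> a <= size z -> bounded z (setv v j a).
Proof. by move=> hv le_a i lt_i; rewrite /setv; case: eqP => // _; apply: hv. Qed.

(** The variables below [d] are the free ones and must survive the run; those from [d] on may be
    overwritten. *)
Definition solves (M : mach) (f : nat -> nat) d (P : seq bool -> (nat -> nat) -> Prop) : Prop :=
  pbound f /\ forall z v, bounded z v -> exists (b : bool) v',
    [/\ b <-> P z v, agree d v v', bounded z v' &
        runs M (mtape K z v) (home z) (f (size z)) (mtape K z v') (home z + b)].

Definition decided d P := exists M f, solves M f d P.

Lemma pbound_unit : pbound (unit_time K).
Proof. by rewrite /unit_time; poly. Qed.

Lemma mtape_yes z v : isSome (mtape K z v (home z + 1)).
Proof. by apply: mtape_some; nia. Qed.

Lemma mtape_le_home z v p : p <= home z -> mtape K z v p = None.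
Proof. by move=> le_p; rewrite /mtape ifF //; move: le_p; rewrite /home; lia. Qed.

Definition branch (D M1 M2 : mach) := seqm D (ifm isSome (seqm left1 M1) M2).

Lemma runs_branch D M1 M2 z v1 v2 t1 (b : bool) t2 T p :
  runs D (mtape K z v1) (home z) t1 (mtape K z v2) (home z + b) ->
  runs (if b then M1 else M2) (mtape K z v2) (home z) t2 T p ->
  runs (branch D M1 M2) (mtape K z v1) (home z) (t1 + t2.+2) T p.
Proof.
move=> r1 r2; apply: runs_seq r1 _; case: b r2 => r2.
  apply: runs_if; rewrite mtape_yes addn1.
  exact: (@runs_seq _ _ _ _ 1 _ _ _ _ _ (runs_left1 _ _) r2).
by rewrite addn0; apply: runs_le (leqnSn _) _; apply: runs_if; rewrite mtape_home.
Qed.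

Definition yes := right1.
Definition no := still.

Lemma runs_yesno (b : bool) T p : runs (if b then yes else no) T p 1 T (p + b).
Proof. by case: b; rewrite ?addn1 ?addn0; [apply: runs_right1 | apply: runs_still]. Qed.

(* The body of a loop halts one cell right of [home] to continue, on [home]
   to leave the loop with answer no, and left of [home] to answer yes. *)
Definition loopm (body : mach) :=
  seqm right1 (seqm (whilem isSome (seqm left1 body)) (branch right1 no yes)).

(** [I] is the invariant, with [r] bounding the number of rounds that may still continue, and [Q]
    holds on leaving with answer [b]. *)
Lemma runs_loopm body z t (I : nat -> (nat -> nat) -> Prop) (Q : bool -> (nat -> nat) -> Prop) r v :
  (forall r v, I r v -> exists v',
     (exists2 r', r = r'.+1 & I r' v' /\
        runs body (mtape K z v) (home z) t (mtape K z v') (home z).+1) \/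
     (exists2 b : bool, Q b v' &
        runs body (mtape K z v) (home z) t (mtape K z v') (home z - b))) ->
  I r v -> exists (b : bool) v', Q b v' /\
    runs (loopm body) (mtape K z v) (home z) (r.+1 * t.+2 + 6) (mtape K z v') (home z + b).
Proof.
move=> step Iv.
have [b [v' [Qv' rv']]] : exists (b : bool) v', Q b v' /\
    runs (whilem isSome (seqm left1 body)) (mtape K z v) (home z).+1 (r.+1 * t.+2 + 1)
         (mtape K z v') (home z - b).
  elim: r v Iv => [|r IH] v Iv; have [v' [[r' er [Iv' rv']]|[b Qv' rv']]] := step _ _ Iv => //.
  2: move: er => [er]; subst r'.
  2: have [b [v2 [Qv2 rv2]]] := IH _ Iv'; exists b, v2; split=> //.
  1,3: exists b, v'; split=> //.
  1,2: apply: (@runs_le _ _ _ ((1 + t) + 1).+1); first by nia.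
  1,2: apply: runs_while_step; first by rewrite -addn1 mtape_yes.
  1,3: by apply: runs_seq (runs_left1 _ _) rv'.
  1,2: by apply: runs_while_end; rewrite mtape_le_home // leq_subr.
  apply: (@runs_le _ _ _ ((1 + t) + (r.+1 * t.+2 + 1)).+1); first by nia.
  apply: runs_while_step rv2; first by rewrite -addn1 mtape_yes.
  by apply: runs_seq (runs_left1 _ _) rv'.
exists b, v'; split=> //.
apply: (@runs_le _ _ _ (1 + ((r.+1 * t.+2 + 1) + 4))); first by lia.
apply: runs_seq (runs_right1 _ _) _; apply: runs_seq rv' _.
(* Moving right turns [home z - b] into [home z + ~~ b], so a nonblank cell now means no. *)
apply: (@runs_seq _ _ _ _ 1 (mtape K z v') (home z + ~~ b)).
  have -> : home z + ~~ b = (home z - b).+1 by rewrite /home; case: (b); lia.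
  exact: runs_right1.
clear Qv'; apply: runs_if; case: b; rewrite ?addn0 ?mtape_home ?mtape_yes /=.
  by rewrite addn1; apply: runs_le _ (runs_right1 _ _).
rewrite addn1.
exact: (@runs_seq _ _ _ _ 1 _ _ 1 _ _ (runs_left1 _ _) (runs_still _ _)).
Qed.

Lemma decided_not d P : decided d P -> decided d (fun z v => ~ P z v).
Proof.
move=> [M [f [pf sM]]]; exists (branch M no yes), (fun n => f n + 3); split; first by poly.
move=> z v bv; have [b [v' [eb av bv' rM]]] := sM z v bv.
exists (~~ b), v'; split=> //.
  by rewrite -eb; case: b {eb rM}; split.
apply: runs_branch rM _; case: b {eb} => /=; rewrite ?addn0 ?addn1.
  exact: runs_still.
exact: runs_right1.
Qed.

(** [Q] is evaluated after [P], when scratch variables may have changed, so it must depend on the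
    first [d] variables only. *)
Lemma decided_and d P Q : (forall z v v', agree d v v' -> Q z v -> Q z v') ->
  decided d P -> decided d Q -> decided d (fun z v => P z v /\ Q z v).
Proof.
move=> lQ [M [f [pf sM]]] [N [g [pg sN]]].
exists (branch M N no), (fun n => f n + (2 + (1 + g n))); split; first by poly.
move=> z v bv; have [b [v' [eb av bv' rM]]] := sM z v bv.
case: b eb rM => eb rM; last first.
  exists false, v'; split=> //; first by split=> // -[/eb].
  apply: runs_branch rM _; apply: runs_le _ (runs_yesno false _ _); lia.
have [b [v2 [eb2 av2 bv2 rN]]] := sN z v' bv'.
exists b, v2; split=> //; last 1 first.
- by apply: runs_branch rM _; apply: runs_le _ rN; lia.
- rewrite eb2; split=> [Qv'|[_]]; last exact: lQ.
  by split; [apply/eb | apply: lQ Qv' => i /av].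
- exact: agree_trans av av2.
Qed.

(** [incm] itself obeys the loop convention: it halts right of [home] to try the next value, and on
    [home] when the values are exhausted. *)
Definition searchm d M := seqm (zerom K d) (loopm (branch M left1 (incm K d))).

(** This gives more than a decision of the existential: on success the witness is left in variable
    [d], which lets [decided_iter] compute values. *)
Lemma searchm_spec M f d P : d < K -> (forall z v v', agree d.+1 v v' -> P z v -> P z v') ->
  solves M f d.+1 P ->
  exists g, pbound g /\ forall z v, bounded z v -> exists (b : bool) v',
    [/\ if b then P z (setv v d (v' d)) else forall a, a <= size z -> ~ P z (setv v d a),
        agree d v v', bounded z v' &
        runs (searchm d M) (mtape K z v) (home z) (g (size z)) (mtape K z v') (home z + b)].
Proof.
move=> lt_d lP [pf sM].
pose t n := f n + (2 + unit_time K n * 4).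
exists (fun n => unit_time K n * 6 + ((n + 1) * (t n + 2) + 6)); split.
  by have pu := pbound_unit; rewrite /t; poly.
move=> z v bv.
pose I r w := [/\ w d + r = size z, agree d v w, bounded z w &
  forall a, a < w d -> ~ P z (setv v d a)].
pose Q (b : bool) w := [/\ if b then P z (setv v d (w d)) else
  forall a, a <= size z -> ~ P z (setv v d a), agree d v w & bounded z w].
have setvd w : agree d v w -> agree d.+1 (setv v d (w d)) w.
  by move=> aw i; rewrite ltnS leq_eqVlt /setv; case: eqP => [->|_] //= /aw.
have agreeC e w w' : agree e w w' -> agree e w' w by move=> h i /h.
have [r w [er aw bw fw]||b [v' [[Pb av' bv'] rv']]] :=
  @runs_loopm (branch M left1 (incm K d)) z (t (size z)) I Q (size z) (setv v d 0).
- rewrite /t; have [b [v' [eb av' bv' rM]]] := sM z w bw.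
  have ed : v' d = w d by apply: av'.
  case: b eb rM => eb rM.
    exists v'; right; exists true.
      split=> //; last by apply: agree_trans aw _; apply: agree_le av'.
      by rewrite ed; apply: (lP _ w); [apply: agreeC; apply: setvd | apply/eb].
    apply: (@runs_le _ _ _ (f (size z) + 3)); first by rewrite /unit_time; nia.
    apply: runs_branch rM _; rewrite /home subn1; exact: runs_left1.
  have fa a : a <= w d -> ~ P z (setv v d a).
    rewrite leq_eqVlt => /orP[/eqP-> Pv|]; last exact: fw.
    by have /eb : P z w by apply: lP Pv; apply: setvd.
  have rI := runs_branch rM (@runs_incm K z v' d lt_d (bv' _ lt_d)).
  have le_t : f (size z) + (unit_time K (size z) * 4).+2 <= t (size z) by [].
  have av2 a : agree d v (setv v' d a).
    apply: agree_trans aw _; apply: agree_trans (agree_setv _ _ (leqnn d)).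
    by apply: agree_le av'.
  move: (runs_le le_t (rI left1)) => {}rI; move: rI; case: ltnP => lt_n rI.
  - exists (setv v' d (v' d).+1); left.
    exists r.-1; first by lia.
    split; last by rewrite -[(home z).+1]addn1.
    split=> //; rewrite ?/setv ?eqxx; [lia | exact: bounded_setv | ].
    by move=> a; rewrite ed ltnS; apply: fa.
  - exists (setv v' d (v' d)); right; exists false; last by rewrite subn0; rewrite addn0 in rI.
    split=> //; last by apply: bounded_setv => //; apply: bv'.
    by move=> a le_a; apply: fa; lia.
- split=> //; [by rewrite /setv eqxx | exact: agree_setv | exact: bounded_setv |].
  by move=> a; rewrite /setv eqxx.
exists b, v'; split=> //.
apply: runs_seq; first by apply: runs_zerom => //; apply: bv.
apply: runs_le _ rv'; rewrite /t; lia.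
Qed.

Lemma decided_ex d P : d < K -> (forall z v v', agree d.+1 v v' -> P z v -> P z v') ->
  decided d.+1 P ->
  decided d (fun z v => exists a, a <= size z /\ P z (setv v d a)).
Proof.
move=> lt_d lP [M [f sM]]; have [g [pg sg]] := searchm_spec lt_d lP sM.
exists (searchm d M), g; split=> // z v bv; have [b [v' [Pb av bv' r]]] := sg z v bv.
exists b, v'; split=> //; case: b Pb r => Pb r; split=> //.
- by move=> _; exists (v' d); split=> //; apply: bv'.
- by move=> [a [le_a]]; move/(Pb a le_a).
Qed.

Lemma decided_bit d i : i < K -> decided d (fun z v => nth false z (v i)).
Proof.
move=> lt_i; exists (readm K i 0), (fun n => unit_time K n * 4); split.
  by have pu := pbound_unit; poly.
move=> z v bv; exists (nth false z (v i)), v; split=> //.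
by have := @runs_readm K z v i 0 lt_i isT (bv _ lt_i).
Qed.

Lemma decided_eq d i j : i < K -> j < K -> decided d (fun z v => v i = v j).
Proof.
move=> lt_i lt_j; exists (readm K i j.+1), (fun n => unit_time K n * 4); split.
  by have pu := pbound_unit; poly.
move=> z v bv; exists (v j == v i), v; split=> //.
  by split=> [/eqP|->].
by have := @runs_readm K z v i j.+1 lt_i lt_j (bv _ lt_i).
Qed.

(** The scratch variable [d] receives a copy of [v i] and is incremented; if that fails, [v i] is
    maximal and no variable holds its successor. *)
Lemma decided_succ d i j : d < K -> i < d -> j < d -> decided d (fun z v => v j = (v i).+1).
Proof.
move=> lt_d lt_i lt_j.
exists (seqm (copym K d i) (branch (incm K d) (readm K d j.+1) no)),
  (fun n => unit_time K n * 6 + (unit_time K n * 4 + (2 + (1 + unit_time K n * 4)))); split.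
  by have pu := pbound_unit; poly.
move=> z v bv.
have [lti ltj] : i < K /\ j < K by split; apply: ltn_trans lt_d.
have [nid njd] : (i == d) = false /\ (j == d) = false by rewrite !ltn_eqF.
have rc := @runs_copym K z v d i lt_d lti (negbT (etrans (eq_sym _ _) nid)) (bv _ lt_d) (bv _ lti).
set u := setv v d (v i) in rc.
have ud : u d = v i by rewrite /u /setv eqxx.
have ri := @runs_incm K z u d lt_d; rewrite ud setv_setv in ri.
set w := setv _ _ _ in ri; move: ri => /(_ (bv _ lti)) ri.
have wd : w d = if v i < size z then (v i).+1 else v i by rewrite /w /setv eqxx.
have wj : w j = v j by rewrite /w /setv njd.
have bw : bounded z w.
  apply: bounded_setv => //; case: ltnP => // _; exact: bv.
have aw : agree d v w by apply: agree_setv.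
exists (v j == (v i).+1), w; split=> //; first by split=> [/eqP|->].
apply: runs_seq rc _; apply: runs_branch ri _.
case: ltnP => lt_n.
  have := @runs_readm K z w d j.+1 lt_d ltj (bw _ lt_d).
  by rewrite /= wd lt_n wj; apply: runs_le; lia.
have -> : (v j == (v i).+1) = false by have := bv _ ltj; lia.
by apply: runs_le _ (runs_yesno false _ _); lia.
Qed.

End Decisions.

(** * Iteration and definable predicates *)

Section Iter.
Variable K : nat.

Lemma leq_iter (G : nat -> nat) a b x : (forall x, x <= G x) -> a <= b ->
  iter a G x <= iter b G x.
Proof.
move=> hG /subnK <-; elim: (b - a) => [|c IH]; first by rewrite add0n.
by rewrite addSn iterS; apply: leq_trans IH (hG _).
Qed.

(** Variable [d] counts the rounds, [d.+1] holds the current iterate and [d.+2] searches for the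
    next one through the graph of [G]. An iterate may leave the range of the variables; as [G] never
    decreases its argument, all later ones stay out of range and the answer is no. *)
Lemma decided_iter d i j k (G : seq bool -> (nat -> nat) -> nat -> nat) :
  i < d -> j < d -> k < d -> d.+2 < K ->
  (forall z v v' x, agree d v v' -> G z v' x = G z v x) ->
  (forall z v x, x <= G z v x) ->
  decided K d.+3 (fun z v => v d.+2 = G z v (v d.+1)) ->
  decided K d (fun z v => v k = iter (v i) (G z v) (v j)).
Proof.
move=> lt_i lt_j lt_k lt_d lG hG [M [f sM]].
have [|g [pg sg]] := @searchm_spec K M f d.+2 _ lt_d _ sM.
  move=> z v v' av; have ad : agree d v v' by apply: agree_le av; lia.
  by rewrite (lG z v v' _ ad) !av.
pose U := unit_time K; have pu := @pbound_unit K : pbound U.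
pose t n := U n * 4 + (2 + (U n * 4 + (2 + (g n + (2 + (U n * 6 + U n * 4)))))).
pose body := branch (readm K d i.+1) (branch (readm K d.+1 k.+1) left1 still)
  (branch (searchm K d.+2 M) (seqm (copym K d.+1 d.+2) (incm K d)) still).
exists (seqm (zerom K d) (seqm (copym K d.+1 j) (loopm body))),
  (fun n => U n * 6 + (U n * 6 + ((n + 1) * (t n + 2) + 6))).
split; first by rewrite /t; poly.
move=> z v bv.
have [lti ltj ltk ltd ltd1] : [/\ i < K, j < K, k < K, d < K & d.+1 < K] by split; lia.
pose I r w := [/\ w d + r = v i, agree d v w, bounded K z w &
  w d.+1 = iter (w d) (G z v) (v j)].
pose Q (b : bool) w := [/\ b <-> v k = iter (v i) (G z v) (v j), agree d v w & bounded K z w].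
pose v1 := setv v d 0; pose v2 := setv v1 d.+1 (v j).
have b1 : bounded K z v1 by apply: bounded_setv.
have b2 : bounded K z v2 by apply: bounded_setv => //; apply: bv.
have a2 : agree d v v2.
  by apply: agree_trans (agree_setv _ _ (leqnn d)) (agree_setv _ _ (leqnSn d)).
have v1j : v1 j = v j by rewrite /v1 /setv ltn_eqF.
have I2 : I (v i) v2.
  split=> //; rewrite /v2 /v1 /setv ?eqxx ltn_eqF ?eqxx //.
have [r w [er aw bw ew]|b [v' [[Pb av' bv'] rv']]] :=
  @runs_loopm K body z (t (size z)) I Q (v i) v2 _ I2; last first.
  exists b, v'; split=> //; apply: runs_seq.
    by apply: runs_zerom => //; apply: bv.
  apply: runs_seq; first apply: (@runs_copym K z v1 d.+1 j) => //; last 1 first.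
  - rewrite v1j; apply: runs_le _ rv'.
    by have := bv _ lti; rewrite addn1 addn2 leq_add2r => le_v; rewrite leq_mul2r ltnS le_v orbT.
  - by lia.
  - by apply: b1.
  - by apply: b1.
have wi : w i = v i by apply: aw.
have wk : w k = v k by apply: aw.
have r1 := @runs_readm K z w d i.+1 ltd lti (bw _ ltd).
rewrite /= wi in r1.
have agreeC e w1 w2 : agree e w1 w2 -> agree e w2 w1 by move=> h x /h.
case: eqP r1 => [ei|ni] r1.
  have r2 := @runs_readm K z w d.+1 k.+1 ltd1 ltk (bw _ ltd1).
  rewrite /= wk in r2.
  exists w; right; exists (v k == w d.+1).
    by split=> //; rewrite ew ei; split=> [/eqP|->].
  apply: (@runs_le _ _ _ (U (size z) * 4 + (U (size z) * 4 + 1.+2).+2)); first by rewrite /t; lia.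
  apply: runs_branch r1 _; apply: runs_branch r2 _.
  case: eqP => _; last by rewrite subn0; apply: runs_still.
  by rewrite /home subn1; apply: runs_left1.
have [b [w' [Pb aw' bw' r2]]] := sg z w bw.
have ew1 : w' d.+1 = w d.+1 by apply: aw'.
have ewd : w' d = w d by apply: aw'.
have lGw a : G z (setv w d.+2 a) (setv w d.+2 a d.+1) = G z v (w d.+1).
  rewrite {2}/setv ltn_eqF //; apply: lG; apply: agree_trans aw _.
  by apply: agree_setv; lia.
case: b Pb r2 => Pb r2; last first.
  exists w'; right; exists false.
    split=> //; last by apply: agree_trans aw _; apply: agree_le aw'; lia.
    split=> // ek; have := bv _ ltk; rewrite ek => le_it.
    (* Were [v k] the final iterate, the next one would not exceed it, hence be in range, and the
       search would have found it. *)
    have le_G : G z v (w d.+1) <= size z.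
      by rewrite ew -iterS; apply: leq_trans le_it; apply: leq_iter => //; lia.
    by case: (Pb _ le_G); rewrite lGw /setv eqxx.
  apply: (@runs_le _ _ _ (U (size z) * 4 + (g (size z) + 1.+2).+2)); first by rewrite /t; lia.
  apply: runs_branch r1 _; apply: runs_branch r2 _.
  by rewrite subn0; apply: runs_still.
move: Pb; rewrite lGw /setv eqxx => Pb.
have ndd : d.+1 != d.+2 by lia.
have r3 := @runs_copym K z w' d.+1 d.+2 ltd1 lt_d ndd (bw' _ ltd1) (bw' _ lt_d).
set u := setv _ _ _ in r3.
have bu : bounded K z u by apply: bounded_setv => //; apply: bw'.
have ud : u d = w d by rewrite /u /setv ltn_eqF.
have r4 := @runs_incm K z u d ltd (bu _ ltd); rewrite ud in r4.
have lt_wd : w d < size z by have := bv _ lti; lia.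
rewrite lt_wd in r4; exists (setv u d (w d).+1); left; exists r.-1; first by lia.
split; last first.
  apply: (@runs_le _ _ _ (U (size z) * 4 + (g (size z) + (U (size z) * 6 + U (size z) * 4).+2).+2)).
    by rewrite /t; lia.
  apply: runs_branch r1 _; apply: runs_branch r2 _; apply: runs_seq r3 _.
  by rewrite -[(home z).+1]addn1.
split.
- by rewrite /setv eqxx; lia.
- apply: agree_trans aw _; apply: agree_trans (agree_setv _ _ (leqnn d)).
  by apply: agree_trans (agree_setv _ _ (leqnSn d)); apply: agree_le aw'; lia.
- by apply: bounded_setv.
- by rewrite /setv eqxx (gtn_eqF (ltnSn d)) /u /setv eqxx Pb ew iterS.
Qed.

End Iter.

(* The environment of a predicate is reached through [rho], so that variables
   can be renamed freely; the levels from [d] on are scratch space. *)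
Definition definable (P : seq bool -> (nat -> nat) -> Prop) : Prop :=
  exists D, forall K d (rho : nat -> nat), (forall i, rho i < d) -> d + D <= K ->
    decided K d (fun z v => P z (fun i => v (rho i))).

Lemma agree_env d v v' (rho : nat -> nat) : (forall i, rho i < d) -> agree d v v' ->
  (fun i => v' (rho i)) = (fun i => v (rho i)).
Proof. by move=> hr av; apply: functional_extensionality => i; rewrite av. Qed.

Lemma in_P_definable P : definable P -> in_P (fun z => P z (fun=> 0)).
Proof.
move=> [D dP]; have [M [f [[C [k hf]] sM]]] := dP (1 + D) 1 (fun=> 0) (fun=> isT) (leqnn _).
set K := 1 + D in sM.
(* [prep_time] takes a string but depends on its length only; [nseq n true] stands for any string of
   length [n]. *)
have [C' [k' ht]] : pbound (fun n => prep_time K (nseq n true) + f n + 2).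
  rewrite /prep_time /append_time /unit_time.
  have -> : (fun n => (size (nseq n true)).+1 *
    (10 * (size (nseq n true)).+2 * K.+2 + 5 * (size (nseq n true)).+2) +
    (10 * (size (nseq n true)).+2 * K.+2 + 2 * (4 * (size (nseq n true)).+2 * K.+2)) + f n + 2) =
    (fun n => n.+1 * (10 * n.+2 * K.+2 + 5 * n.+2) +
    (10 * n.+2 * K.+2 + 2 * (4 * n.+2 * K.+2)) + f n + 2).
    by apply: functional_extensionality => n; rewrite size_nseq.
  by have pf : pbound f; [exists C, k | poly].
(* The factor [2 ^ k'] pays for passing from the base [n.+1] to [n]; the additive constant covers
   the empty input. *)
exists (tm_of (seqm (prep K) M)), (C' * 2 ^ k'), k' => z.
have b0 : bounded K z (vars0 K z) by move=> i lt_i; rewrite /vars0 lt_i.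
have [b [v' [eb _ _ r]]] := sM z _ b0; exists b; split; last first.
  by move: eb; rewrite (_ : vars0 K z 0 = 0).
have rr := runs_seq (runs_prep K z) r.
have := tm_of_runs rr; rewrite (_ : isSome _ = b); last first.
  by case: b {eb r rr}; rewrite ?mtape_yes // addn0 mtape_home.
apply: tm_run_le; apply: leq_trans (_ : C' * (size z).+1 ^ k' <= _).
  have := ht (size z); rewrite /prep_time /append_time size_nseq; lia.
rewrite -mulnA -mulnDr leq_mul2l; apply/orP; right.
case: (size z) => [|n]; first by rewrite exp1n; have := expn_gt0 2 k'; lia.
rewrite -expnMn; apply: leq_trans (leq_addr _ _); by case: k' {ht} => // k'; rewrite leq_exp2r //; lia.
Qed.

(** * Closure of definability under first-order operations *)

Definition inrange (z : seq bool) (e : nat -> nat) : Prop := forall i, e i <= size z.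

Lemma decided_iff K d P Q : (forall z v, bounded K z v -> (P z v <-> Q z v)) ->
  decided K d P -> decided K d Q.
Proof.
move=> PQ [M [f [pf sM]]]; exists M, f; split=> // z v bv.
have [b [v' [eb av bv' r]]] := sM z v bv; exists b, v'; split=> //.
by rewrite eb; apply: PQ.
Qed.

Lemma def_iff P Q : (forall z e, inrange z e -> (P z e <-> Q z e)) -> definable P -> definable Q.
Proof.
move=> PQ [D dP]; exists D => K d rho hr le_D; apply: decided_iff (dP K d rho hr le_D).
move=> z v bv; apply: PQ => i; apply: bv; apply: leq_trans (hr i) _.
by apply: leq_trans le_D; rewrite leq_addr.
Qed.

Lemma def_ren (s : nat -> nat) P : definable P -> definable (fun z e => P z (fun i => e (s i))).
Proof.
move=> [D dP]; exists D => K d rho hr le_D.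
exact: (dP K d (fun i => rho (s i)) (fun i => hr (s i)) le_D).
Qed.

Lemma def_not P : definable P -> definable (fun z e => ~ P z e).
Proof. by move=> [D dP]; exists D => K d rho hr le_D; apply: decided_not; apply: dP. Qed.

Lemma def_and P Q : definable P -> definable Q -> definable (fun z e => P z e /\ Q z e).
Proof.
move=> [D dP] [D' dQ]; exists (D + D') => K d rho hr le_D.
apply: decided_and; [|apply: dP => //; lia|apply: dQ => //; lia].
by move=> z v v' av; rewrite (agree_env hr av).
Qed.

Lemma def_imp P Q : definable P -> definable Q -> definable (fun z e => P z e -> Q z e).
Proof.
move=> dP dQ; apply: (def_iff _ (def_not (def_and dP (def_not dQ)))) => z e _.
split=> [h p|h [p q]]; last exact/q/h.
by apply: NNPP => q; apply: h.
Qed.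

Lemma def_or P Q : definable P -> definable Q -> definable (fun z e => P z e \/ Q z e).
Proof.
move=> dP dQ; apply: (def_iff _ (def_imp (def_not dP) dQ)) => z e _.
by split=> [h|[]//]; have [p|/h] := classic (P z e); [left|right].
Qed.

Lemma def_iffp P Q : definable P -> definable Q -> definable (fun z e => P z e <-> Q z e).
Proof. by move=> dP dQ; apply: def_and; apply: def_imp. Qed.

(** The bound variable becomes index 0 of the environment and the others shift by one; on the tape
    it is stored at the fresh level [d]. *)
Lemma def_ex P : definable (fun z e => P z (fun i => e i.+1) (e 0)) ->
  definable (fun z e => exists r, r <= size z /\ P z e r).
Proof.
move=> [D dP]; exists D.+1 => K d rho hr le_D.
pose rho' i := if i is i'.+1 then rho i' else d.
have hr' i : rho' i < d.+1 by case: i => [|i] //=; rewrite ltnW // ltnS hr.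
have {dP} := dP K d.+1 rho' hr'; rewrite addSnnS => /(_ le_D) dP.
have lt_d : d < K by lia.
apply: decided_iff (decided_ex lt_d _ dP) => [z v bv|z v v' av]; last first.
  have ad : agree d v v' by apply: agree_le av.
  by rewrite /= (agree_env hr ad) av.
have e r : (fun i => setv v d r (rho i)) = (fun i => v (rho i)).
  by apply: functional_extensionality => i; rewrite /setv ltn_eqF.
have e' r : setv v d r d = r by rewrite /setv eqxx.
by split=> -[r hP]; exists r; move: hP; rewrite /= e e'.
Qed.

Lemma def_eqv i j : definable (fun z e => e i = e j).
Proof. by exists 0 => K d rho hr le_D; apply: decided_eq; apply: leq_trans (hr _) _; lia. Qed.

Lemma def_bitv i : definable (fun z e => nth false z (e i)).
Proof. by exists 0 => K d rho hr le_D; apply: decided_bit; apply: leq_trans (hr _) _; lia. Qed.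

Lemma def_succv i j : definable (fun z e => e j = (e i).+1).
Proof. by exists 1 => K d rho hr le_D; apply: decided_succ => //; lia. Qed.

Lemma decided_add K d i j k : i < d -> j < d -> k < d -> d + 3 < K ->
  decided K d (fun z v => v k = v i + v j).
Proof.
move=> lt_i lt_j lt_k lt_d.
have ds : decided K d.+3 (fun z v => v d.+2 = (v d.+1).+1) by apply: decided_succ; lia.
have lt2 : d.+2 < K by lia.
apply: decided_iff (@decided_iter K d i j k (fun _ _ => S) lt_i lt_j lt_k lt2
  (fun _ _ _ _ _ => erefl) (fun _ _ => leqnSn) ds) => z v _.
by have -> : iter (v i) succn (v j) = v i + v j by elim: (v i) => //= n ->.
Qed.

Lemma def_addv i j k : definable (fun z e => e k = e i + e j).
Proof. by exists 4 => K d rho hr le_D; apply: decided_add => //; lia. Qed.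

Lemma def_iter_add i l j k : definable (fun z e => e k = e i * e l + e j).
Proof.
exists 7 => K d rho hr le_D.
have hr' x : rho x < d.+3 by apply: leq_trans (hr x) _; lia.
have da : decided K d.+3 (fun z v => v d.+2 = v (rho l) + v d.+1) by apply: decided_add => //; lia.
have lt2 : d.+2 < K by lia.
apply: decided_iff (@decided_iter K d (rho i) (rho j) (rho k) (fun z v x => v (rho l) + x)
  (hr i) (hr j) (hr k) lt2 _ (fun _ _ _ => leq_addl _ _) da) => [z v _|z v v' x av].
  have -> // : iter (v (rho i)) (addn (v (rho l))) (v (rho j)) = v (rho i) * v (rho l) + v (rho j).
  by elim: (v (rho i)) => //= n ->; rewrite mulSn addnA.
by rewrite av.
Qed.

(** A term is given by its graph, so its value may leave the range of the variables: no variable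
    then equals it. *)
Definition tdef (t : seq bool -> (nat -> nat) -> nat) : Prop :=
  definable (fun z e => e 0 = t z (fun i => e i.+1)).

Lemma tdef_ren t (s : nat -> nat) : tdef t -> tdef (fun z e => t z (fun i => e (s i))).
Proof. by move=> dt; apply: (def_ren (fun i => if i is i'.+1 then (s i').+1 else 0) dt). Qed.

(** Substitution through a variable for the value. The result is false when the value is out of
    range, and each use has to settle that case. *)
Lemma def_subst t P : tdef t -> definable (fun z e => P z (fun i => e i.+1) (e 0)) ->
  definable (fun z e => exists r, r <= size z /\ (r = t z e /\ P z e r)).
Proof. by move=> dt dP; apply: def_ex; apply: def_and. Qed.

Lemma def_bit t : tdef t -> definable (fun z e => nth false z (t z e)).
Proof.
move=> dt; apply: def_iff (def_subst dt (P := fun z e r => nth false z r) (def_bitv 0)) => z e _.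
split=> [[r [_ [-> ]]] //|h]; exists (t z e); split=> //.
(* Past the end the default is [false], so a true bit bounds the value of the term. *)
by rewrite leqNgt; apply: contraL h => /ltnW le; rewrite nth_default.
Qed.

Lemma def_eqt i t : tdef t -> definable (fun z e => e i = t z e).
Proof. by move=> dt; apply: (def_ren (fun j => if j is j'.+1 then j' else i) dt). Qed.

Lemma tdef_var i : tdef (fun z e => e i).
Proof. exact: def_eqv. Qed.

Lemma tdef0 : tdef (fun _ _ => 0).
Proof.
apply: def_iff (def_not (@def_ex (fun z e r => e 0 = r.+1) (def_succv 0 1))) => z e he.
split=> [h|-> [r []//]]; case e0: (e 0) => [|r] //; case: h; exists r; split=> //.
by have := he 0; rewrite e0 => /ltnW.
Qed.

Lemma tdefS t : tdef t -> tdef (fun z e => (t z e).+1).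
Proof.
move=> dt; apply: def_iff (def_subst (t := fun z e => t z (fun i => e i.+1))
  (P := fun z e r => e 0 = r.+1) (tdef_ren _ dt) (def_succv 0 1)) => z e he.
split=> [[r [_ [-> ]]] //|h]; exists (t z (fun i => e i.+1)); split=> //.
by apply: ltnW; rewrite -h.
Qed.

Lemma tdefD t1 t2 : tdef t1 -> tdef t2 -> tdef (fun z e => t1 z e + t2 z e).
Proof.
move=> d1 d2.
apply: def_iff (def_subst (t := fun z e => t1 z (fun i => e i.+1))
  (P := fun z e r => exists r', r' <= size z /\ (r' = t2 z (fun i => e i.+1) /\ e 0 = r + r'))
  (tdef_ren _ d1) (def_subst (t := fun z e => t2 z (fun i => e i.+2))
   (P := fun z e r => e 1 = e 0 + r) (tdef_ren _ d2) (def_addv 1 0 2))) => z e he.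
split=> [[r [_ [-> [r' [_ [-> ]]]]]] //|h].
exists (t1 z (fun i => e i.+1)); split; first by have := he 0; lia.
by split=> //; exists (t2 z (fun i => e i.+1)); split; first by have := he 0; lia.
Qed.

Lemma def_le t i : tdef t -> definable (fun z e => t z e <= e i).
Proof.
move=> dt.
apply: def_iff (def_subst (P := fun z e r => exists r', r' <= size z /\ e i = r + r') dt
  (@def_ex (fun z e r => e i.+1 = e 0 + r) (def_addv 1 0 i.+2))) => z e he.
split=> [[r [_ [-> [r' [_ ->]]]]] |h]; first exact: leq_addr.
exists (t z e); split; first exact: leq_trans h (he i).
split=> //; exists (e i - t z e); split; last by rewrite subnKC.
by apply: leq_trans (leq_subr _ _) (he i).
Qed.

Lemma def_lt i t : tdef t -> definable (fun z e => e i < t z e).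
Proof.
move=> dt; apply: def_iff (def_not (def_le i dt)) => z e _.
by rewrite ltnNge; split=> /negP.
Qed.

(** A factor can be out of range although the product is not, but only if the other factor is 0;
    that case is a separate disjunct. *)
Lemma tdefM t1 t2 : tdef t1 -> tdef t2 -> tdef (fun z e => t1 z e * t2 z e).
Proof.
move=> d1 d2.
have z1 : definable (fun z e => e 0 = 0) by exact: def_eqt tdef0.
have d0 t : tdef t -> definable (fun z e => exists r, r <= size z /\
    (r = t z (fun i => e i.+1) /\ r = 0)).
  move=> dt; apply: (def_subst (t := fun z e => t z (fun i => e i.+1))
    (P := fun z e r => r = 0) (tdef_ren _ dt) z1).
pose T z e := exists r, r <= size z /\ (r = t1 z (fun i => e i.+1) /\
   exists r', r' <= size z /\ (r' = t2 z (fun i => e i.+1) /\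
   exists r'', r'' <= size z /\ (r'' = 0 /\ e 0 = r * r' + r''))).
have dT : definable T.
  apply: (def_subst (t := fun z e => t1 z (fun i => e i.+1))
    (P := fun z e r => exists r', r' <= size z /\ (r' = t2 z (fun i => e i.+1) /\
      exists r'', r'' <= size z /\ (r'' = 0 /\ e 0 = r * r' + r'')))
    (tdef_ren _ d1)).
  apply: (def_subst (t := fun z e => t2 z (fun i => e i.+2))
    (P := fun z e r' => exists r'', r'' <= size z /\ (r'' = 0 /\ e 1 = e 0 * r' + r''))
    (tdef_ren _ d2)).
  apply: (def_subst (t := fun z e => 0)
    (P := fun z e r' => e 2 = e 1 * e 0 + r') tdef0).
  exact: (def_iter_add 2 1 0 3).
apply: def_iff (def_or dT (def_and z1 (def_or (d0 _ d1) (d0 _ d2)))) => z e he.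
split.
  case=> [[r [_ [-> [r' [_ [-> [r'' [_ [-> ->]]]]]]]]]|[-> [] [r [_ [<- ->]]]]].
  - by rewrite addn0.
  - by rewrite mul0n.
  - by rewrite muln0.
have := he 0; set u := t1 _ _; set w := t2 _ _; move=> le_e ee.
have [u0|u0] := posnP u; first by right; split; [lia | left; exists 0].
have [w0|w0] := posnP w; first by right; split; [lia | right; exists 0].
left; exists u; split; first by nia.
split=> //; exists w; split; first by nia.
by split=> //; exists 0; split=> //; split=> //; rewrite addn0.
Qed.

Lemma def_exlt i P : definable (fun z e => P z (fun j => e j.+1) (e 0)) ->
  definable (fun z e => exists r, r < e i /\ P z e r).
Proof.
move=> dP; apply: def_iff (@def_ex (fun z e r => r < e i /\ P z e r)
  (def_and (def_lt 0 (tdef_var i.+1)) dP)) => z e he.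
split=> [[r [_ h]]|[r [lt_r h]]]; exists r => //.
by split=> //; apply: leq_trans (he i); apply: ltnW.
Qed.

Lemma def_exle i P : definable (fun z e => P z (fun j => e j.+1) (e 0)) ->
  definable (fun z e => exists r, r <= e i /\ P z e r).
Proof.
move=> dP; apply: def_iff (@def_ex (fun z e r => r <= e i /\ P z e r)
  (def_and (def_le i.+1 (tdef_var 0)) dP)) => z e he.
split=> [[r [_ h]]|[r [lt_r h]]]; exists r => //.
by split=> //; apply: leq_trans (he i).
Qed.

Lemma def_alllt i P : definable (fun z e => P z (fun j => e j.+1) (e 0)) ->
  definable (fun z e => forall r, r < e i -> P z e r).
Proof.
move=> dP; apply: def_iff (def_not (def_exlt i (P := fun z e r => ~ P z e r) (def_not dP))) => z e _.
split=> [h r lt_r|h [r [lt_r]]]; last by apply; apply: h.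
by apply: NNPP => nP; apply: h; exists r.
Qed.

Lemma def_allle i P : definable (fun z e => P z (fun j => e j.+1) (e 0)) ->
  definable (fun z e => forall r, r <= e i -> P z e r).
Proof.
move=> dP; apply: def_iff (def_not (def_exle i (P := fun z e r => ~ P z e r) (def_not dP))) => z e _.
split=> [h r lt_r|h [r [lt_r]]]; last by apply; apply: h.
by apply: NNPP => nP; apply: h; exists r.
Qed.

Lemma def_andb (f g : seq bool -> (nat -> nat) -> bool) :
  definable f -> definable g -> definable (fun z e => f z e && g z e).
Proof. by move=> df dg; apply: def_iff (def_and df dg) => z e _; split=> /andP. Qed.

Ltac define_term :=
  lazymatch goal with
  | |- tdef (fun z e => @?t1 z e + @?t2 z e) => apply: (@tdefD t1 t2); define_term
  | |- tdef (fun z e => @?t1 z e * @?t2 z e) => apply: (@tdefM t1 t2); define_term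
  | |- tdef (fun z e => (@?t z e).+1) => apply: (@tdefS t); define_term
  | |- tdef (fun z e => 0) => exact: tdef0
  | |- tdef (fun z e => e ?i) => exact: (tdef_var i)
  end.

(** The patterns expect quantifiers bounded by a variable or by [size z], and comparisons with a
    variable on one side; this dictates the shape of the formulas below. *)
Ltac define :=
  cbv beta;
  lazymatch goal with
  | |- definable (fun z e => @?P z e /\ @?Q z e) => apply: (@def_and P Q); define
  | |- definable (fun z e => @?P z e \/ @?Q z e) => apply: (@def_or P Q); define
  | |- definable (fun z e => @?P z e <-> @?Q z e) => apply: (@def_iffp P Q); define
  | |- definable (fun z e => ~ @?P z e) => apply: (@def_not P); define
  | |- definable (fun z e => is_true (@?f z e && @?g z e)) => apply: (@def_andb f g); define
  | |- definable (fun z e => exists r, is_true (r < e ?i) /\ @?P z e r) =>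
      apply: (@def_exlt i P); define
  | |- definable (fun z e => exists r, is_true (r <= e ?i) /\ @?P z e r) =>
      apply: (@def_exle i P); define
  | |- definable (fun z e => exists r, is_true (r <= size z) /\ @?P z e r) =>
      apply: (@def_ex P); define
  | |- definable (fun z e => forall r, is_true (r < e ?i) -> @?P z e r) =>
      apply: (@def_alllt i P); define
  | |- definable (fun z e => forall r, is_true (r <= e ?i) -> @?P z e r) =>
      apply: (@def_allle i P); define
  | |- definable (fun z e => @?P z e -> @?Q z e) => apply: (@def_imp P Q); define
  | |- definable (fun z e => e ?i = @?t z e) => apply: (@def_eqt i t); define_term
  | |- definable (fun z e => is_true (e ?i < @?t z e)) => apply: (@def_lt i t); define_term
  | |- definable (fun z e => is_true (@?t z e <= e ?i)) => apply: (@def_le t i); define_term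
  | |- definable (fun z e => is_true (nth false z (@?t z e))) => apply: (@def_bit t); define_term
  end.

(** * Parsing tokens *)

(* Pair [i] of the input consists of the bits [2i] and [2i+1]; the second one
   tells a digit from a separator.  Intended meaning of the guessed tables:
   [P k i] says that [k] separators precede pair [i], [V i v] that the digits
   from pair [i] on up to the next separator have value [v], and [Q i j] that
   the digits from [i] on and from [j] on agree.  Labels can exceed the range of
   [V], hence [Q]. *)
Section TokenFormula.
Variables (a h : nat) (X : nat -> bool) (P V Q : nat -> nat -> bool).

(** Digits come least significant first. Excluding a final zero digit and an unterminated number
    leaves exactly the concatenations of canonical encodings. *)
Definition pairs_wf : Prop := forall i, i < h ->
  (X (i + i) -> X (i + i).+1) /\
  (X (i + i).+1 -> i.+1 < h /\ (~ X (i + i) -> X (i + i).+3)).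

(** The step clauses force the intended entries, and the uniqueness clause excludes all others. *)
Definition count_wf : Prop :=
  P 0 0 /\
  (forall i, i < h -> forall k, k <= a -> P k i ->
     (X (i + i).+1 -> P k i.+1) /\ (~ X (i + i).+1 -> P k.+1 i.+1)) /\
  (forall i, i <= h -> forall k, k <= a -> forall k', k' <= a ->
     P k i -> P k' i -> k = k').

Definition value_wf : Prop := forall i, i < h -> forall v, v <= a ->
  (~ X (i + i).+1 -> (V i v <-> v = 0)) /\
  (X (i + i).+1 -> (V i v <-> exists w, w <= a /\ (V i.+1 w /\
     ((X (i + i) /\ v = (w + w).+1) \/ (~ X (i + i) /\ v = w + w))))).

Definition equal_wf : Prop := forall i, i < h -> forall j, j < h ->
  (Q i j <-> (~ X (i + i).+1 /\ ~ X (j + j).+1) \/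
             (X (i + i).+1 /\ X (j + j).+1 /\ (X (i + i) <-> X (j + j)) /\ Q i.+1 j.+1)).

(** Pair [i] begins a token: its predecessor, reached by a bounded quantifier, is a separator or
    does not exist. *)
Definition start i : Prop := forall j, j < i -> i = j.+1 -> ~ X (j + j).+1.

Definition tok k v : Prop := exists i, i < h /\ (start i /\ P k i /\ V i v).

Definition teq k k' : Prop := exists i, i < h /\ exists j, j < h /\
  (start i /\ start j /\ P k i /\ P k' j /\ Q i j).

End TokenFormula.

Fixpoint toks (s : seq bool) : seq nat :=
  match s with
  | b :: t :: s' =>
      if t then (if toks s' is v :: r then (b + (v + v)) :: r else [::])
      else 0 :: toks s'
  | _ => [::]
  end.

Lemma bin_of_nat_fuel_eq f f' n : n <= f -> n <= f' ->
  bin_of_nat_fuel f n = bin_of_nat_fuel f' n.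
Proof.
elim: f f' n => [|f IH] [|f'] [|n] //= le_f le_f'.
by congr (_ :: _); apply: IH; lia.
Qed.

Lemma enc_nat_double (b : bool) v : 0 < b + (v + v) ->
  enc_nat (b + (v + v)) = b :: true :: enc_nat v.
Proof.
rewrite addnn /enc_nat; case e: (b + v.*2) => [|n] // _.
have -> : bin_of_nat_fuel n.+1 n.+1 = odd n.+1 :: bin_of_nat_fuel n n.+1./2 by [].
rewrite -e oddD odd_double addbF oddb half_bit_double.
by rewrite (@bin_of_nat_fuel_eq n v v) //; lia.
Qed.

(** The induction that follows the digits of [enc_nat], least significant first. *)
Lemma nat_double_ind (T : nat -> Prop) : T 0 ->
  (forall (b : bool) v, 0 < b + (v + v) -> T v -> T (b + (v + v))) -> forall n, T n.
Proof.
move=> T0 TS n; elim/ltn_ind: n => n IH; have [->//|n0] := posnP n.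
have en : odd n + (n./2 + n./2) = n by rewrite addnn odd_double_half.
by rewrite -en; apply: TS; rewrite ?en //; apply: IH; lia.
Qed.

Lemma toks_enc_nat n s : toks (enc_nat n ++ s) = n :: toks s.
Proof. by elim/nat_double_ind: n => // b v gt0 IH; rewrite enc_nat_double //= IH. Qed.

Lemma toks_enc ts : toks (flatten (map enc_nat ts)) = ts.
Proof. by elim: ts => //= n ts IH; rewrite toks_enc_nat IH. Qed.

Definition pairs_ok s := exists2 h, size s = h + h & pairs_wf h (nth false s).

Lemma pairs_ok_cons b (t : bool) s :
  pairs_ok (b :: t :: s) <->
  [/\ pairs_ok s, b -> t & t -> 0 < size s /\ (~ b -> nth false s 1)].
Proof.
split=> [[[|h] //= es hw]|[[h es hw] bt tb]].
  have {}es : size s = h + h by lia.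
  have [bt tb] := hw 0 isT; split=> //; last first.
    by move=> /tb [lt_h ns]; split=> //; lia.
  exists h => // i lt_i; have := hw i.+1 lt_i; rewrite !addSn !addnS /=.
  by rewrite ltnS.
exists h.+1 => /=; first by lia.
case=> [|i] lt_i /=; last by have := hw i lt_i; rewrite !addSn !addnS /= ltnS.
by split=> // /tb [gt0 nb]; split=> //; lia.
Qed.

Lemma pairs_ok_enc ts : pairs_ok (flatten (map enc_nat ts)).
Proof.
elim: ts => [|n ts IH] /=; first by exists 0.
set s := flatten _ in IH *.
suff [] : pairs_ok (enc_nat n ++ s) /\ nth false (enc_nat n ++ s) 1 = (0 < n) by [].
elim/nat_double_ind: n => [|b v gt0 [IH1 IH2]].
  by split=> //; apply/pairs_ok_cons.
rewrite enc_nat_double // gt0; split=> //; apply/pairs_ok_cons; split=> // _.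
split; first by rewrite /enc_nat !size_cat addn2.
by move=> nb; rewrite IH2; case: b nb gt0 => // _; case: v {IH1 IH2}.
Qed.

(** The last two conjuncts strengthen the induction: [enc_nat_double] applies to a digit only if a
    token follows for it to extend, with a positive value when the digit is 0. *)
Lemma enc_toks s : pairs_ok s ->
  [/\ flatten (map enc_nat (toks s)) = s, (0 < size s) = (0 < size (toks s)) &
      (0 < head 0 (toks s)) = nth false s 1].
Proof.
move: {2}(size s) (leqnn (size s)) => m; elim: m s => [|m IH] [|b [|t s]] //=.
  by move=> _ [[|h]] //=; lia.
move=> le_m /pairs_ok_cons[ok bt tb].
have [|e1 e2 e3] := IH s _ ok; first by lia.
case: t bt tb => bt tb; last first.
  by split; rewrite //= e1; case: b bt {tb} => // /(_ isT).
have [gt0 nb] := tb isT; move: e2 e1 e3; rewrite gt0.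
case: (toks s) => //= v r _ e1 e3.
have pos : 0 < b + (v + v).
  by case: b {bt tb} nb => // /(_ notF); rewrite -e3; case: v {e1 e3}.
by split; rewrite ?pos // enc_nat_double //= e1.
Qed.

(** * What the guessed tables say about the tokens of the input *)

Section TokenSemantics.
Variables (x : seq bool) (h : nat) (P V Q : nat -> nat -> bool).
Let X := nth false x.
Let a := size x.
Let ts := toks x.
Hypothesis ha : size x = h + h.
Hypothesis hX : pairs_wf h X.

Let tsi i := toks (drop (i + i) x).
Let val i := head 0 (tsi i).
Fixpoint seps i := if i is j.+1 then seps j + ~~ X (j + j).+1 else 0.

Lemma tsi_unfold i : i < h -> tsi i =
  if X (i + i).+1 then (if tsi i.+1 is v :: r then (X (i + i) + (v + v)) :: r else [::])
  else 0 :: tsi i.+1.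
Proof.
move=> lt_i; rewrite /tsi addSn addnS (drop_nth false (n := i + i)) ?ha; last by lia.
by rewrite (drop_nth false (n := (i + i).+1)) ?ha; last by lia.
Qed.

Lemma tsi_end : tsi h = [::].
Proof. by rewrite /tsi -ha drop_size. Qed.

(** A value is determined by the digits to its right, so the inductions run backwards from the last
    pair. *)
Lemma back_ind (T : nat -> Prop) :
  (forall i, i < h -> (i.+1 < h -> T i.+1) -> T i) -> forall i, i < h -> T i.
Proof.
move=> TS; suff H n i : h - i <= n -> i < h -> T i by move=> i; apply: (H h); lia.
by elim: n i => [|n IH] i le_n lt_i; [lia | apply: TS => // ?; apply: IH; lia].
Qed.

Lemma size_tsi i : i < h -> size (tsi i) = (size (tsi i.+1)) + ~~ X (i + i).+1 /\ 0 < size (tsi i).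
Proof.
move: i; apply: back_ind => i lt_i IH; rewrite tsi_unfold //.
case D: (X _); last by rewrite addn1.
have [_ /(_ D) [lt_i1 _]] := hX lt_i; have [_] := IH lt_i1.
by case: (tsi i.+1) => //= v r; rewrite addn0.
Qed.

Lemma val_unfold i : i < h -> val i = if X (i + i).+1 then X (i + i) + (val i.+1 + val i.+1) else 0.
Proof.
move=> lt_i; rewrite /val tsi_unfold //; case D: (X _) => //.
have [_ /(_ D) [lt_i1 _]] := hX lt_i; have [_] := size_tsi lt_i1.
by case: (tsi i.+1).
Qed.

Lemma val_gt0 i : i < h -> (0 < val i) = X (i + i).+1.
Proof.
move: i; apply: back_ind => i lt_i IH; rewrite val_unfold //.
case D: (X _) => //; have [_ /(_ D) [lt_i1 nX]] := hX lt_i.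
case: (X (i + i)) nX => // /(_ notF) nX; have := IH lt_i1.
by rewrite addSn addnS nX; lia.
Qed.

Lemma seps_size i : i <= h -> size (tsi i) + seps i = size ts.
Proof.
elim: i => [|i IH] lt_i; first by rewrite /tsi drop0 addn0.
by rewrite -IH ?(ltnW lt_i) //= (size_tsi lt_i).1; lia.
Qed.

Lemma seps_le i : seps i <= i.
Proof. by elim: i => //= i IH; case: (X _); lia. Qed.

Lemma size_ts : size ts = seps h.
Proof. by rewrite -(@seps_size h) // tsi_end. Qed.

(** Inside a token the suffix begins with a partial value, so only its tail is a tail of [ts]; this
    weaker half carries the induction across digits. *)
Lemma tsi_drop i : i < h -> (start X i -> tsi i = drop (seps i) ts) /\
  behead (tsi i) = drop (seps i).+1 ts.
Proof.
elim: i => [|i IH] lt_i; first by rewrite /tsi !drop0 drop1.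
have [IHs IHb] := IH (ltnW lt_i).
have eb : behead (tsi i.+1) = drop (seps i.+1).+1 ts /\
    (~~ X (i + i).+1 -> tsi i.+1 = drop (seps i.+1) ts).
  move: IHb; rewrite tsi_unfold ?(ltnW lt_i) //=; case: (X _) => //=.
    by have [_] := size_tsi lt_i; case: (tsi i.+1) => //= v r _ ->; rewrite addn0.
  by rewrite addn1 => e; split=> // ; rewrite e -drop1 drop_drop add1n.
split=> [st|]; last by case: eb.
by apply: eb.2; apply/negP; apply: (st i).
Qed.

(** Token [k] begins at the least pair that has [k] separators before it. *)
Lemma seps_start k : k < size ts -> exists2 i, i < h & start X i /\ seps i = k.
Proof.
move=> lt_k; have ex : exists i, k <= seps i by exists h; rewrite -size_ts ltnW.
case: (ex_minnP ex) => i le_k min_i; exists i.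
  rewrite ltn_neqAle min_i -?size_ts ?(ltnW lt_k) // andbT; apply/eqP => ei.
  case: i ei le_k min_i => [|i] ei le_k min_i.
    by move: lt_k; rewrite size_ts -ei.
  have lt_i : i < h by rewrite -ei.
  have [nD|D] := boolP (X (i + i).+1).
    have [_ /(_ nD) []] := hX lt_i; by rewrite -ei ltnn.
  suff: i.+1 <= i by rewrite ltnn.
  by apply: min_i; move: lt_k; rewrite size_ts -ei /= D addn1.
case: i le_k min_i => [|i] le_k min_i; first by split=> //; apply/esym/eqP; rewrite -leqn0.
have lt_s : seps i < k by rewrite ltnNge; apply/negP => /min_i; rewrite ltnn.
have D : ~~ X (i + i).+1.
  by apply/negP => D; move: le_k; rewrite /= D addn0 leqNgt lt_s.
split; first by move=> j _ [<-]; apply/negP.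
by move: le_k lt_s; rewrite /= D; lia.
Qed.

Lemma nth_start i : i < h -> start X i -> seps i < size ts /\ nth 0 ts (seps i) = val i.
Proof.
move=> lt_i st; have [/(_ st) e _] := tsi_drop lt_i.
have [_ gt0] := size_tsi lt_i; split; first by move: gt0; rewrite e size_drop subn_gt0.
by rewrite /val e -nth0 nth_drop addn0.
Qed.

Lemma size_ts_le : size ts <= a.
Proof. by rewrite size_ts /a ha; apply: leq_trans (seps_le h) (leq_addr _ _). Qed.

Section Guessed.
Hypothesis hP : count_wf a h X P.
Hypothesis hV : value_wf a h X V.
Hypothesis hQ : equal_wf h X Q.

Lemma countP k i : k <= a -> i <= h -> P k i <-> k = seps i.
Proof.
move=> le_k le_i; have [P0 [PS Pu]] := hP.
have le_a j : j <= h -> seps j <= a by move=> le_j; rewrite /a ha; have := seps_le j; lia.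
have Ps : P (seps i) i.
  elim: i le_i => [|i IH] lt_i //=.
  have [Pd Pn] := PS i lt_i _ (le_a _ (ltnW lt_i)) (IH (ltnW lt_i)).
  case D: (X _); first by rewrite addn0; apply: Pd.
  by rewrite addn1; apply: Pn; rewrite D.
by split=> [Pk|->//]; apply: (Pu i le_i) => //; apply: le_a.
Qed.

Lemma valueP i v : i < h -> v <= a -> V i v <-> v = val i.
Proof.
move=> lt_i; move: i lt_i v; apply: back_ind => i lt_i IH v le_v.
have [Vn Vd] := hV lt_i le_v; rewrite val_unfold //.
case D: (X (i + i).+1) Vn Vd => Vn Vd; last by apply: Vn.
have [_ /(_ D) [lt_i1 _]] := hX lt_i; rewrite Vd //; split.
  by case=> w [le_w [/IH -> // [[-> ->]|[/negP/negbTE-> ->]]]].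
move=> ev; exists (val i.+1); split; first by lia.
split; first by apply/IH => //; lia.
by case: (X (i + i)) ev => ->; [left|right].
Qed.

Lemma equalP i j : i < h -> j < h -> Q i j <-> val i = val j.
Proof.
move=> lt_i; move: i lt_i j; apply: back_ind => i lt_i IH j lt_j.
rewrite (hQ lt_i lt_j) (val_unfold lt_i) (val_unfold lt_j).
have [iS jS] := (hX lt_i, hX lt_j).
(* A number that begins with a digit is positive, which settles a digit against a separator. *)
have [gi gj] := (val_gt0 lt_i, val_gt0 lt_j).
rewrite (val_unfold lt_i) in gi; rewrite (val_unfold lt_j) in gj.
case Di: (X (i + i).+1) iS gi => -[_ iS] gi; case Dj: (X (j + j).+1) jS gj => -[_ jS] gj.
- have [[lt_i1 _] [lt_j1 _]] := (iS isT, jS isT).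
  split=> [[[]//|[_ [_ [eX /IH -> //]]]]|ev].
    by congr (_ + _); case: (X (i + i)) (X (j + j)) eX => [] [] // [h1 h2]; [have := h1 isT|have := h2 isT].
  right; do 2 split=> //.
  have eb : X (i + i) = X (j + j) by move: ev; case: (X (i + i)) (X (j + j)) => [] []; lia.
  by rewrite eb; split=> //; apply/IH => //; move: ev; rewrite eb; lia.
- by split=> [[[]//|[_ []//]]|ev]; rewrite ev in gi.
- by split=> [[[]//|[]//]|ev]; rewrite -ev in gj.
- by split=> // _; left.
Qed.

Lemma tokP k v : k <= a -> v <= a -> tok h X P V k v <-> (k < size ts /\ nth 0 ts k = v).
Proof.
move=> le_k le_v; split.
  case=> i [lt_i [st [Pki Viv]]].
  have -> : k = seps i by apply/countP => //; apply: ltnW.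
  have -> : v = val i by apply/valueP.
  exact: nth_start.
case=> lt_k ek; have [i lt_i [st ei]] := seps_start lt_k.
exists i; split=> //; split=> //; split; first by apply/countP => //; apply: ltnW.
by apply/valueP => //; rewrite -ek -ei; case: (nth_start lt_i st).
Qed.

Lemma teqP k k' : k < size ts -> k' < size ts ->
  teq h X P Q k k' <-> nth 0 ts k = nth 0 ts k'.
Proof.
move=> lt_k lt_k'; have le_ts := size_ts_le.
have [le_k le_k'] : k <= a /\ k' <= a by lia.
split.
  case=> i [lt_i [j [lt_j [si [sj [Pi [Pj /equalP]]]]]]] => /(_ lt_i lt_j).
  move/countP: Pi => -> //; last exact: ltnW.
  move/countP: Pj => -> //; last exact: ltnW.
  by case: (nth_start lt_i si) => _ ->; case: (nth_start lt_j sj) => _ ->.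
move=> ev; have [i lt_i [si ei]] := seps_start lt_k.
have [j lt_j [sj ej]] := seps_start lt_k'.
exists i; split=> //; exists j; split=> //; do 2 split=> //.
split; first by apply/countP => //; apply: ltnW.
split; first by apply/countP => //; apply: ltnW.
apply/equalP => //; move: ev; rewrite -ei -ej.
by case: (nth_start lt_i si) => _ ->; case: (nth_start lt_j sj) => _ ->.
Qed.

Lemma totalP k : k <= a -> P k h <-> k = size ts.
Proof. by move=> le_k; rewrite size_ts; apply: countP. Qed.

End Guessed.

(** * The intended tables satisfy their defining clauses *)

Section Guess.
Hypothesis hP : forall k i, k <= a -> i <= a -> P k i = (k == seps i).
Hypothesis hV : forall i v, i <= a -> v <= a -> V i v = (v == val i).
Hypothesis hQ : forall i j, i <= a -> j <= a -> Q i j = (val i == val j).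

Let le_ha : h <= a. Proof. by rewrite /a ha leq_addr. Qed.

Lemma count_wf_guess : count_wf a h X P.
Proof.
have le_s i : i <= h -> seps i <= a.
  by move=> le_i; apply: leq_trans (seps_le i) (leq_trans le_i le_ha).
split; first by rewrite hP.
split=> [i lt_i k le_k|i le_i k le_k k' le_k'].
  have [le_i lt_ia] : i <= a /\ i < a by lia.
  rewrite hP // => /eqP ek; have := le_s _ lt_i.
  case D: (X (i + i).+1) => /= le_si; split=> // _; rewrite hP //= ?D ek ?addn0 ?addn1 //.
  by rewrite D addn1 in le_si.
have le_ia : i <= a by lia.
by rewrite !hP // => /eqP-> /eqP->.
Qed.

Lemma value_wf_guess : value_wf a h X V.
Proof.
move=> i lt_i v le_v; have [le_i lt_ia] : i <= a /\ i < a by lia.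
rewrite hV // val_unfold //; split=> D.
  by rewrite (negbTE (introN idP D)); split=> /eqP.
rewrite D; split=> [/eqP ev|].
  exists (val i.+1); split; first by lia.
  split; first by rewrite hV ?eqxx //; lia.
  by case: (X (i + i)) ev => ->; [left|right].
case=> w [le_w []]; rewrite hV // => /eqP -> ee.
by apply/eqP; case: ee => [[-> ->]|[/negP/negbTE-> ->]].
Qed.

Lemma equal_wf_guess : equal_wf h X Q.
Proof.
move=> i lt_i j lt_j; have [[le_i lt_ia] [le_j lt_ja]] : (i <= a /\ i < a) /\ (j <= a /\ j < a) by lia.
rewrite !hQ //.
have [gi gj] := (val_gt0 lt_i, val_gt0 lt_j).
case Di: (X (i + i).+1) gi => gi; case Dj: (X (j + j).+1) gj => gj.
- rewrite (val_unfold lt_i) (val_unfold lt_j) Di Dj; split=> [/eqP ev|].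
    right; do 2 split=> //.
    have eb : X (i + i) = X (j + j) by move: ev; case: (X (i + i)) (X (j + j)) => [] []; lia.
    by rewrite eb; split=> //; apply/eqP; move: ev; rewrite eb; lia.
  case=> [[]//|[_ [_ [eX /eqP ->]]]]; apply/eqP; congr (_ + _).
  by case: (X (i + i)) (X (j + j)) eX => [] [] // [h1 h2]; [have := h1 isT|have := h2 isT].
- by split=> [/eqP ev|[[]//|[_ []//]]]; rewrite ev gj in gi.
- by split=> [/eqP ev|[[]//|[]//]]; rewrite -ev gi in gj.
- split=> [_|_]; first by left.
  by apply/eqP; lia.
Qed.

End Guess.
End TokenSemantics.

(** * Formulas about event structures *)

Definition flat (s : seq (nat * nat)) : seq nat := flatten [seq [:: p.1; p.2] | p <- s].

Definition fles_toks E : seq nat :=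
  [:: fl_n E, size (fl_lt E) & flat (fl_lt E) ++
      size (fl_cf E) :: flat (fl_cf E) ++ size (fl_lab E) :: fl_lab E].

Lemma enc_flat s : flatten (map enc_nat (flat s)) = flatten (map enc_pair s).
Proof. by elim: s => //= p s IH; rewrite IH /enc_pair catA. Qed.

Lemma enc_fles_toks E : enc_fles E = flatten (map enc_nat (fles_toks E)).
Proof.
rewrite /enc_fles /enc_list /= !map_cat !flatten_cat /= !map_cat !flatten_cat /= !enc_flat.
by rewrite -!catA.
Qed.

Lemma size_flat s : size (flat s) = size s + size s.
Proof. by elim: s => //= p s ->; rewrite addnS. Qed.

Lemma nth_flat s r : r < size s ->
  nth 0 (flat s) (r + r) = (nth (0, 0) s r).1 /\ nth 0 (flat s) (r + r).+1 = (nth (0, 0) s r).2.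
Proof. by elim: s r => //= p s IH [|r] // /IH; rewrite addnS. Qed.

Lemma unflat s k : size s = k + k -> exists2 u, size u = k & flat u = s.
Proof.
elim: k s => [|k IH] [|p [|q s]] //=; first by exists [::].
  by lia.
move=> es; have [|u eu fu] := IH s; first by lia.
by exists ((p, q) :: u); rewrite /= ?eu // -fu.
Qed.

Lemma nth_catr (T : Type) (x0 : T) s1 s2 i : nth x0 (s1 ++ s2) (size s1 + i) = nth x0 s2 i.
Proof. by rewrite nth_cat ltnNge leq_addr addKn. Qed.

Lemma nth_catl (T : Type) (x0 : T) s1 s2 i : i < size s1 -> nth x0 (s1 ++ s2) i = nth x0 s1 i.
Proof. by rewrite nth_cat => ->. Qed.

Definition reads ts o E : Prop :=
  let l := size (fl_lt E) in let c := size (fl_cf E) in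
  [/\ [/\ nth 0 ts o = fl_n E, nth 0 ts (o + 1) = l, nth 0 ts (o + 2 + (l + l)) = c &
          nth 0 ts (o + 3 + (l + l) + (c + c)) = size (fl_lab E)],
      forall r, r < l -> nth 0 ts (o + 2 + (r + r)) = (nth (0, 0) (fl_lt E) r).1 /\
                         nth 0 ts (o + 3 + (r + r)) = (nth (0, 0) (fl_lt E) r).2,
      forall r, r < c ->
        nth 0 ts (o + 3 + (l + l) + (r + r)) = (nth (0, 0) (fl_cf E) r).1 /\
        nth 0 ts (o + 4 + (l + l) + (r + r)) = (nth (0, 0) (fl_cf E) r).2 &
      forall e, e < size (fl_lab E) ->
        nth 0 ts (o + 4 + (l + l) + (c + c) + e) = nth eps (fl_lab E) e].

Lemma size_fles_toks E : size (fles_toks E) =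
  4 + (size (fl_lt E) + size (fl_lt E)) + (size (fl_cf E) + size (fl_cf E)) + size (fl_lab E).
Proof. by rewrite /= !size_cat /= !size_cat /= !size_flat; lia. Qed.

Lemma reads_toks pre E post : reads (pre ++ fles_toks E ++ post) (size pre) E.
Proof.
rewrite /reads; set l := size (fl_lt E); set c := size (fl_cf E).
set ts := _ ++ _.
have e0 i : nth 0 ts (size pre + i) = nth 0 (fles_toks E ++ post) i by exact: nth_catr.
have e2 i : nth 0 ts (size pre + 2 + i) = nth 0 (flat (fl_lt E) ++ (c :: flat (fl_cf E) ++
    size (fl_lab E) :: fl_lab E) ++ post) i.
  by rewrite -addnA e0 /= -catA.
have e3 i : nth 0 ts (size pre + 2 + (l + l) + i) = nth 0 (c :: flat (fl_cf E) ++
    (size (fl_lab E) :: fl_lab E) ++ post) i.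
  by rewrite -addnA e2 -size_flat nth_catr /= -catA.
have e4 i : nth 0 ts (size pre + 3 + (l + l) + (c + c) + i) =
    nth 0 ((size (fl_lab E) :: fl_lab E) ++ post) i.
  have -> : size pre + 3 + (l + l) + (c + c) + i = size pre + 2 + (l + l) + (c + c + i).+1 by lia.
  by rewrite e3 /= -size_flat nth_catr.
split.
- split.
  + by have := e0 0; rewrite addn0.
  + exact: e0.
  + by have := e3 0; rewrite addn0.
  + by have := e4 0; rewrite addn0.
- move=> r lt_r; have [<- <-] := nth_flat lt_r.
  have -> : size pre + 3 + (r + r) = size pre + 2 + (r + r).+1 by lia.
  by rewrite !e2 !nth_catl ?size_flat //; lia.
- move=> r lt_r; have [<- <-] := nth_flat lt_r.
  have -> : size pre + 3 + (l + l) + (r + r) = size pre + 2 + (l + l) + (r + r).+1 by lia.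
  have -> : size pre + 4 + (l + l) + (r + r) = size pre + 2 + (l + l) + (r + r).+2 by lia.
  by rewrite !e3 /= !nth_catl ?size_flat //; lia.
- move=> e lt_e.
  have -> : size pre + 4 + (l + l) + (c + c) + e = size pre + 3 + (l + l) + (c + c) + e.+1 by lia.
  by rewrite e4 /= nth_catl.
Qed.

(** Any tokens with consistent lengths decode as an event structure, well formed or not;
    well-formedness is tested afterwards. *)
Lemma drop_fles ts o n l c : o + 4 + (l + l) + (c + c) + n <= size ts ->
  nth 0 ts o = n -> nth 0 ts (o + 1) = l -> nth 0 ts (o + 2 + (l + l)) = c ->
  nth 0 ts (o + 3 + (l + l) + (c + c)) = n ->
  exists E, [/\ fl_n E = n, size (fl_lt E) = l, size (fl_cf E) = c, size (fl_lab E) = n &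
    drop o ts = fles_toks E ++ drop (o + 4 + (l + l) + (c + c) + n) ts].
Proof.
move=> le_s en el ec eq.
have cut k j : k + j <= size ts -> exists2 s, size s = j & drop k ts = s ++ drop (k + j) ts.
  move=> le_k; exists (take j (drop k ts)); first by rewrite size_takel // size_drop; lia.
  by rewrite addnC -drop_drop cat_take_drop.
have [|s1 es1 d1] := cut (o + 2) (l + l); first by lia.
have [|s2 es2 d2] := cut (o + 3 + (l + l)) (c + c); first by lia.
have [|s3 es3 d3] := cut (o + 4 + (l + l) + (c + c)) n; first by lia.
have [lt elt flt] := unflat es1; have [cf ecf fcf] := unflat es2.
exists (mkFLES n lt cf s3); split=> //=.
rewrite (drop_nth 0); last by lia.
rewrite (drop_nth 0); last by lia.
rewrite en -[X in nth 0 ts X]addn1 el (_ : o.+2 = o + 2); last by rewrite addn2.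
rewrite d1.
rewrite (drop_nth 0); last by lia.
rewrite ec (_ : _.+1 = o + 3 + (l + l)) ?d2; last by lia.
rewrite (drop_nth 0); last by lia.
rewrite eq (_ : _.+1 = o + 4 + (l + l) + (c + c)) ?d3; last by lia.
by rewrite elt ecf es3 flt fcf -!catA /= -!catA.
Qed.

Section FlesFormula.
Variables (tk : nat -> nat -> Prop) (o n l c : nat).

(** Requiring [n] again as the number of labels builds in the first clause of [wf_fles]. *)
Definition headF : Prop :=
  tk o n /\ tk (o + 1) l /\ tk (o + 2 + (l + l)) c /\ tk (o + 3 + (l + l) + (c + c)) n.

Definition ltF e e' : Prop :=
  exists r, r < l /\ (tk (o + 2 + (r + r)) e /\ tk (o + 3 + (r + r)) e').

Definition cfF e e' : Prop :=
  exists r, r < c /\ (tk (o + 3 + (l + l) + (r + r)) e /\ tk (o + 4 + (l + l) + (r + r)) e').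

Definition epsF e : Prop := tk (o + 4 + (l + l) + (c + c) + e) 0.

Definition rangeF : Prop :=
  (forall r, r < l -> (exists e, e < n /\ tk (o + 2 + (r + r)) e) /\
                      (exists e, e < n /\ tk (o + 3 + (r + r)) e)) /\
  (forall r, r < c -> (exists e, e < n /\ tk (o + 3 + (l + l) + (r + r)) e) /\
                      (exists e, e < n /\ tk (o + 4 + (l + l) + (r + r)) e)).

(** The clauses quantify over events only; [rangeF] lifts them to all numbers. *)
Definition wfF : Prop :=
  rangeF /\
  (forall e, e < n -> ~ ltF e e) /\
  (forall e1, e1 < n -> forall e2, e2 < n -> forall e3, e3 < n ->
     ltF e1 e2 -> ltF e2 e3 -> ltF e1 e3) /\
  (forall e1, e1 < n -> forall e2, e2 < n -> cfF e1 e2 -> cfF e2 e1) /\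
  (forall e, e < n -> ~ cfF e e) /\
  (forall e1, e1 < n -> forall e2, e2 < n -> forall e3, e3 < n ->
     cfF e1 e2 -> ltF e2 e3 -> cfF e1 e3) /\
  exists b, b < n /\ ((forall e, e < n -> ~ ltF e b) /\
    (forall e, e < n -> ~ e = b -> ltF b e) /\ epsF b).

(* [W i e] stands for "the event in position [i] is [e]". *)
Definition traceF (W : nat -> nat -> Prop) m : Prop :=
  (forall i, i < m -> exists e, e < n /\ W i e) /\
  (forall i, i < m -> forall e, e < n -> forall e', e' < n -> W i e -> W i e' -> e = e') /\
  (forall i, i < m -> forall j, j < m -> forall e, e < n -> W i e -> W j e -> i = j) /\
  (forall i, i < m -> forall j, j < m -> forall e, e < n -> forall e', e' < n ->
     W i e -> W j e' -> ltF e e' -> i < j) /\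
  (forall i, i < m -> forall e, e < n -> forall e', e' < n -> W i e -> ltF e' e ->
     exists j, j < m /\ W j e') /\
  (forall i, i < m -> forall j, j < m -> forall e, e < n -> forall e', e' < n ->
     W i e -> W j e' -> ~ cfF e e') /\
  (forall e, e < n -> (exists i, i < m /\ W i e) \/
     exists i, i < m /\ exists e', e' < n /\ (W i e' /\ cfF e' e)).

Definition visibleF (W : nat -> nat -> Prop) i : Prop :=
  exists e, e < n /\ (W i e /\ ~ epsF e).

End FlesFormula.

(** The last clause, read at [i = i'], excludes both [j < j'] and [j' < j], so it makes [B]
    functional, and symmetrically injective, besides monotone. *)
Definition matchF (vis1 vis2 : nat -> Prop) (same : nat -> nat -> Prop)
    (B : nat -> nat -> bool) m1 m2 : Prop :=
  (forall i, i < m1 -> vis1 i -> exists j, j < m2 /\ B i j) /\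
  (forall j, j < m2 -> vis2 j -> exists i, i < m1 /\ B i j) /\
  (forall i, i < m1 -> forall j, j < m2 -> B i j -> vis1 i /\ vis2 j /\ same i j) /\
  (forall i, i < m1 -> forall i', i' < m1 -> forall j, j < m2 -> forall j', j' < m2 ->
     B i j -> B i' j' -> (i < i' <-> j < j')).

(** * Equality of words as an order isomorphism of visible positions *)

Section MatchWords.
Variables (m1 m2 : nat) (f1 f2 : nat -> nat).
Let word (m : nat) f := [seq a <- map f (iota 0 m) | a != eps].
Let idx (m : nat) (f : nat -> nat) := [seq i <- iota 0 m | f i != eps].

Let wordE m f : word m f = map f (idx m f).
Proof. by rewrite /word filter_map. Qed.

Let mem_idx m f i : (i \in idx m f) = (i < m) && (f i != eps).
Proof. by rewrite mem_filter mem_iota /= andbC. Qed.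

Let sorted_idx m f : sorted ltn (idx m f).
Proof. by apply: sorted_filter; [apply: ltn_trans | apply: iota_ltn_sorted]. Qed.

(** [B] induces an increasing map from [idx m1 f1] onto [idx m2 f2]; increasing lists with the same
    members coincide, and matched labels agree. *)
Lemma matchF_words B :
  matchF (fun i => f1 i != eps) (fun j => f2 j != eps) (fun i j => f1 i = f2 j) B m1 m2 ->
  word m1 f1 = word m2 f2.
Proof.
case=> [tot1 [tot2 [com mono]]]; pose g i := find (B i) (iota 0 m2).
have gP i : i \in idx m1 f1 -> g i < m2 /\ B i (g i).
  rewrite mem_idx => /andP[lt_i ni]; have [j [lt_j Bij]] := tot1 i lt_i ni.
  have hB : has (B i) (iota 0 m2) by apply/hasP; exists j; rewrite ?mem_iota.
  have lt_g : g i < m2 by have := hB; rewrite has_find size_iota.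
  by split=> //; have := nth_find 0 hB; rewrite nth_iota.
have lt1 i : i \in idx m1 f1 -> i < m1 by rewrite mem_idx => /andP[].
have eg : map g (idx m1 f1) = idx m2 f2.
  apply: (irr_sorted_eq ltn_trans ltnn) => //.
    apply: (@homo_sorted_in _ _ (mem (idx m1 f1)) g ltn ltn) (sorted_idx _ _).
      move=> i i' ii ii' lt_ii; have [[lg Bg] [lg' Bg']] := (gP _ ii, gP _ ii').
      exact/(mono i (lt1 _ ii) i' (lt1 _ ii') _ lg _ lg' Bg Bg').
    exact/allP.
  move=> j; apply/mapP/idP => [[i ii ->]|].
    have [lg Bg] := gP _ ii; rewrite mem_idx lg.
    by case: (com i (lt1 _ ii) _ lg Bg) => _ [].
  rewrite mem_idx => /andP[lt_j nj]; have [i [lt_i Bij]] := tot2 j lt_j nj.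
  have ii : i \in idx m1 f1 by rewrite mem_idx lt_i; case: (com i lt_i j lt_j Bij).
  (* The order clause with [i] on both sides leaves [g i = j] as the only possibility. *)
  exists i => //; have [lg Bg] := gP _ ii; have m := mono i lt_i i lt_i.
  have n1 : ~ g i < j by move/(m _ lg _ lt_j Bg Bij).2; rewrite ltnn.
  have n2 : ~ j < g i by move/(m _ lt_j _ lg Bij Bg).2; rewrite ltnn.
  by lia.
rewrite !wordE -eg -map_comp; apply/eq_in_map => i ii /=.
by have [lg Bg] := gP _ ii; case: (com i (lt1 _ ii) _ lg Bg) => _ [].
Qed.

(** Here [B] pairs visible positions of equal rank; equal words have equally many of them. *)
Lemma words_matchF (B : nat -> nat -> bool) : word m1 f1 = word m2 f2 ->
  (forall i j, i < m1 -> j < m2 -> B i j =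
    [&& f1 i != eps, f2 j != eps & index i (idx m1 f1) == index j (idx m2 f2)]) ->
  matchF (fun i => f1 i != eps) (fun j => f2 j != eps) (fun i j => f1 i = f2 j) B m1 m2.
Proof.
move=> ew hB; have es : size (idx m1 f1) = size (idx m2 f2).
  by have := congr1 size ew; rewrite !wordE !size_map.
have lt_mono m f i i' : i \in idx m f -> i' \in idx m f ->
    (i < i') = (index i (idx m f) < index i' (idx m f)).
  move=> ii ii'; have H := @sorted_ltn_index _ _ ltn_trans _ (sorted_idx m f).
  have [h1 h2] := (H i i' ii ii', H i' i ii' ii).
  case: (ltngtP (index i _) (index i' _)) => [/h1|/h2 lt|/(index_inj 0 ii ii') ->] //.
    by apply/negbTE; rewrite -leqNgt ltnW.
  by rewrite ltnn.
split.
  move=> i lt_i ni; have ii : i \in idx m1 f1 by rewrite mem_idx lt_i.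
  have lt_x : index i (idx m1 f1) < size (idx m2 f2) by rewrite -es index_mem.
  have := mem_nth 0 lt_x; set j := nth 0 _ _ => jj.
  have := jj; rewrite mem_idx => /andP[lt_j nj]; exists j; split=> //.
  by rewrite hB // ni nj index_uniq ?eqxx // filter_uniq // iota_uniq.
split.
  move=> j lt_j nj; have jj : j \in idx m2 f2 by rewrite mem_idx lt_j.
  have lt_x : index j (idx m2 f2) < size (idx m1 f1) by rewrite es index_mem.
  have := mem_nth 0 lt_x; set i := nth 0 _ _ => ii.
  have := ii; rewrite mem_idx => /andP[lt_i ni]; exists i; split=> //.
  by rewrite hB // ni nj index_uniq ?eqxx // filter_uniq // iota_uniq.
split.
  move=> i lt_i j lt_j; rewrite hB // => /and3P[ni nj /eqP ei]; split=> //; split=> //.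
  have ii : i \in idx m1 f1 by rewrite mem_idx lt_i.
  have jj : j \in idx m2 f2 by rewrite mem_idx lt_j.
  rewrite -(nth_index 0 ii) -(nth_index 0 jj) -ei.
  rewrite -(nth_map 0 eps) ?index_mem // -(nth_map 0 eps) -?es ?index_mem //.
  by rewrite -!wordE ew.
move=> i lt_i i' lt_i' j lt_j j' lt_j'; rewrite !hB //.
move=> /and3P[ni nj /eqP ei] /and3P[ni' nj' /eqP ei'].
have -> := lt_mono m1 f1 i i' _ _; rewrite ?mem_idx ?lt_i ?lt_i' //.
by have -> := lt_mono m2 f2 j j' _ _; rewrite ?mem_idx ?lt_j ?lt_j' // ei ei'.
Qed.

End MatchWords.

(** * Maximality without quantifying over configurations *)

Section ConfigurationTheory.
Variable E : fles.
Hypothesis hE : wf_fles E.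

(** An event [e] in conflict with no member of [C] can be added together with the events below it: a
    conflict in the larger set would be inherited upwards to one of [e] with itself or with a member
    of [C]. *)
Lemma max_conf_conflict C : is_max_conf E C <->
  is_conf E C /\ forall e, ev E e -> e \notin C -> exists c, c \in C /\ cf_ev E c e.
Proof.
have [_ [lt_rng cf_rng] [lt_irr lt_tr] [cf_sym cf_irr cf_inh] _] := hE.
split=> [[conf max]|[conf dom]]; split=> //; last first.
  case=> C' [[rng' _ free'] [sub [e [eC' eC]]]].
  have [c [cC ce]] := dom e (rng' _ eC') eC.
  by have := free' c e (sub _ cC) eC'; rewrite ce.
move=> e ve eC; apply: NNPP => none; apply: max.
have {}none c : c \in C -> ~~ cf_ev E c e.
  by move=> cC; apply/negP => ce; apply: none; exists c.
have [rng down free] := conf.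
pose D := [seq e' <- iota 0 (fl_n E) | lt_ev E e' e].
have memD e' : (e' \in D) = lt_ev E e' e.
  by rewrite mem_filter mem_iota /=; case l: (lt_ev _ _ _) => //=; case: (lt_rng _ _ l).
exists (e :: D ++ C); split; last first.
  split; first by move=> c cC; rewrite inE mem_cat cC !orbT.
  by exists e; rewrite inE eqxx.
have memP e' : e' \in e :: D ++ C -> [\/ e' = e, lt_ev E e' e | e' \in C].
  rewrite inE mem_cat memD => /orP[/eqP->|/orP[]].
  - exact: Or31.
  - exact: Or32.
  - exact: Or33.
have below e1 e2 : cf_ev E e1 e2 -> e2 = e \/ lt_ev E e2 e -> cf_ev E e1 e.
  by move=> c [<-//|]; apply: cf_inh.
split.
- by move=> e' /memP[->|/lt_rng[]|/rng].
- move=> e1 e2 /memP[->|l|e1C] l21; rewrite inE mem_cat memD.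
  + by rewrite l21 orbT.
  + by rewrite (lt_tr _ _ _ l21 l) orbT.
  + by rewrite (down _ _ e1C l21) !orbT.
- have key e1 e2 : e1 = e \/ lt_ev E e1 e -> e2 = e \/ lt_ev E e2 e -> ~~ cf_ev E e1 e2.
    move=> h1 h2; apply/negP => c; have := cf_irr e.
    by rewrite (below _ _ (cf_sym _ _ (below _ _ c h2)) h1).
  have key' e1 e2 : e1 \in C -> e2 = e \/ lt_ev E e2 e -> ~~ cf_ev E e1 e2.
    by move=> h1 h2; apply/negP => c; have := none _ h1; rewrite (below _ _ c h2).
  move=> e1 e2 /memP h1 /memP h2.
  have {}h1 : (e1 = e \/ lt_ev E e1 e) \/ e1 \in C by case: h1; auto.
  have {}h2 : (e2 = e \/ lt_ev E e2 e) \/ e2 \in C by case: h2; auto.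
  case: h1 h2 => [h1|h1] [h2|h2]; [exact: key| |exact: key'|exact: free].
  by apply/negP => /cf_sym; apply/negP; apply: key'.
Qed.

Lemma traces_size t : traces E t -> size t <= fl_n E.
Proof.
case=> C [[[rng _ _] _] [ut mt _]]; rewrite -(size_iota 0 (fl_n E)).
by apply: uniq_leq_size => // e /mt /rng; rewrite mem_iota.
Qed.

End ConfigurationTheory.

(** * Meaning of the formulas in a given event structure *)

Section FlesSemantics.
Variables (E : fles) (tk : nat -> nat -> Prop) (ts : seq nat) (o a : nat).
Let n := fl_n E.
Let l := size (fl_lt E).
Let c := size (fl_cf E).
Hypothesis size_lab : size (fl_lab E) = n.
Hypothesis le_n : n <= a.
Hypothesis hr : reads ts o E.
(** Labels may exceed [a], so [tk] is reliable only for values up to [a]; this suffices for events,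
    lengths and the test against [eps]. *)
Hypothesis htk : forall k v, k < o + size (fles_toks E) -> v <= a -> tk k v <-> nth 0 ts k = v.

Let szE : size (fles_toks E) = 4 + (l + l) + (c + c) + n.
Proof. by rewrite size_fles_toks size_lab. Qed.

Lemma ltFE e e' : e <= a -> e' <= a -> ltF tk o l e e' <-> lt_ev E e e'.
Proof.
have sz := szE.
have [_ rl _ _] := hr; move=> le_e le_e'; split.
  case=> r [lt_r []]; rewrite !htk //; try lia.
  case: (rl r lt_r) => -> -> <- <-.
  by rewrite /lt_ev -surjective_pairing mem_nth.
move=> /(nthP (0, 0))[r]; rewrite -/l => lt_r er; exists r; split=> //.
by rewrite !htk //; try lia; case: (rl r lt_r) => -> ->; rewrite er.
Qed.

Lemma cfFE e e' : e <= a -> e' <= a -> cfF tk o l c e e' <-> cf_ev E e e'.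
Proof.
have sz := szE.
have [_ _ rc _] := hr; move=> le_e le_e'; split.
  case=> r [lt_r []]; rewrite !htk //; try lia.
  case: (rc r lt_r) => -> -> <- <-.
  by rewrite /cf_ev -surjective_pairing mem_nth.
move=> /(nthP (0, 0))[r]; rewrite -/c => lt_r er; exists r; split=> //.
by rewrite !htk //; try lia; case: (rc r lt_r) => -> ->; rewrite er.
Qed.

Lemma epsFE e : e < n -> epsF tk o l c e <-> lab E e = eps.
Proof.
have sz := szE.
have [_ _ _ re] := hr; move=> lt_e; rewrite /epsF htk //; last by lia.
by rewrite re // size_lab.
Qed.

Lemma headFE : c <= a -> l <= a -> headF tk o n l c.
Proof.
have sz := szE.
move=> le_c le_l; have [[e1 e2 e3 e4] _ _ _] := hr.
by rewrite /headF !htk //; try lia; rewrite e1 e2 e3 e4 size_lab.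
Qed.

Lemma rangeFE : rangeF tk o n l c <->
  (forall e e', lt_ev E e e' -> ev E e /\ ev E e') /\
  (forall e e', cf_ev E e e' -> ev E e /\ ev E e').
Proof.
have sz := szE.
have [_ rl rc _] := hr; split=> -[h1 h2]; split.
- move=> e e' /(nthP (0, 0))[r]; rewrite -/l => lt_r er.
  have [[e1 [lt1 t1]] [e2 [lt2 t2]]] := h1 r lt_r; move: t1 t2.
  rewrite !htk //; try lia; case: (rl r lt_r) => -> ->.
  by rewrite er /= /ev => -> ->.
- move=> e e' /(nthP (0, 0))[r]; rewrite -/c => lt_r er.
  have [[e1 [lt1 t1]] [e2 [lt2 t2]]] := h2 r lt_r; move: t1 t2.
  rewrite !htk //; try lia; case: (rc r lt_r) => -> ->.
  by rewrite er /= /ev => -> ->.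
- move=> r lt_r; have [e1 e2] := rl r lt_r.
  have [] := h1 (nth (0, 0) (fl_lt E) r).1 (nth (0, 0) (fl_lt E) r).2.
    by rewrite /lt_ev -surjective_pairing mem_nth.
  rewrite /ev => lt1 lt2; split.
    by exists (nth (0, 0) (fl_lt E) r).1; split=> //; rewrite htk //; lia.
  by exists (nth (0, 0) (fl_lt E) r).2; split=> //; rewrite htk //; lia.
- move=> r lt_r; have [e1 e2] := rc r lt_r.
  have [] := h2 (nth (0, 0) (fl_cf E) r).1 (nth (0, 0) (fl_cf E) r).2.
    by rewrite /cf_ev -surjective_pairing mem_nth.
  rewrite /ev => lt1 lt2; split.
    by exists (nth (0, 0) (fl_cf E) r).1; split=> //; rewrite htk //; lia.
  by exists (nth (0, 0) (fl_cf E) r).2; split=> //; rewrite htk //; lia.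
Qed.

Let lea e : e < n -> e <= a. Proof. by move=> lt_e; lia. Qed.

Lemma wfFE : wfF tk o n l c <-> wf_fles E.
Proof.
split.
  case=> /rangeFE[rl rc] [irr [tr [sym [cirr [inh [b [lt_b [min [bot eb]]]]]]]]].
  split=> //; last 1 first.
  - exists b; split=> //.
    + move=> e; apply/negP => le; have [ve _] := rl _ _ le.
      by apply: (min e ve); apply/ltFE => //; apply: lea.
    + by move=> e ve /eqP ne; apply/ltFE; [apply: lea| apply: lea| apply: bot].
    + exact/epsFE.
  - split.
      by move=> e; apply/negP => le; have [ve _] := rl _ _ le; apply: (irr e ve); apply/ltFE => //; apply: lea.
    move=> e1 e2 e3 l12 l23; have [v1 v2] := rl _ _ l12; have [_ v3] := rl _ _ l23.
    by apply/ltFE; [exact: lea | exact: lea |]; apply: (tr e1 v1 e2 v2 e3 v3); apply/ltFE => //; apply: lea.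
  - split.
    + move=> e1 e2 c12; have [v1 v2] := rc _ _ c12.
      by apply/cfFE; [exact: lea | exact: lea |]; apply: (sym e1 v1 e2 v2); apply/cfFE => //; apply: lea.
    + by move=> e; apply/negP => ce; have [ve _] := rc _ _ ce; apply: (cirr e ve); apply/cfFE => //; apply: lea.
    + move=> e1 e2 e3 c12 l23; have [v1 v2] := rc _ _ c12; have [_ v3] := rl _ _ l23.
      apply/cfFE; [exact: lea | exact: lea |]; apply: (inh e1 v1 e2 v2 e3 v3).
        by apply/cfFE => //; apply: lea.
      by apply/ltFE => //; apply: lea.
case=> _ rng [irr tr] [sym cirr inh] [b [vb min bot eb]].
split; first exact/rangeFE.
split; first by move=> e ve /ltFE; rewrite (negbTE (irr e)) => h; have := h (lea ve) (lea ve).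
split.
  move=> e1 v1 e2 v2 e3 v3 /ltFE l12 /ltFE l23; apply/ltFE; [exact: lea|exact: lea|].
  by apply: (tr _ e2); [apply: l12 | apply: l23]; apply: lea.
split.
  move=> e1 v1 e2 v2 /cfFE c12; apply/cfFE; [exact: lea|exact: lea|].
  by apply: sym; apply: c12; apply: lea.
split; first by move=> e ve /cfFE; rewrite (negbTE (cirr e)) => h; have := h (lea ve) (lea ve).
split.
  move=> e1 v1 e2 v2 e3 v3 /cfFE c12 /ltFE l23; apply/cfFE; [exact: lea|exact: lea|].
  by apply: (inh _ e2); [apply: c12 | apply: l23]; apply: lea.
exists b; split=> //; split.
  by move=> e ve /ltFE; rewrite (negbTE (min e)) => h; have := h (lea ve) (lea vb).
split; last exact/epsFE.
by move=> e ve ne; apply/ltFE; [exact: lea|exact: lea|apply: bot => //; apply/eqP].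
Qed.

Section Traces.
Hypothesis hE : wf_fles E.

Let W (t : seq nat) i e : Prop := i < size t /\ nth 0 t i = e.

Lemma traceF_ext W1 W2 m : (forall i e, i < m -> e < n -> W1 i e <-> W2 i e) ->
  traceF tk o n l c W1 m -> traceF tk o n l c W2 m.
Proof.
move=> e12 [h1 [h2 [h3 [h4 [h5 [h6 h7]]]]]].
have f i e : i < m -> e < n -> W1 i e -> W2 i e by move=> lt_i lt_e; case: (e12 i e lt_i lt_e).
have b i e : i < m -> e < n -> W2 i e -> W1 i e by move=> lt_i lt_e; case: (e12 i e lt_i lt_e).
split.
  by move=> i lt_i; have [e [lt_e w]] := h1 i lt_i; exists e; split=> //; apply: f.
split.
  move=> i lt_i e lt_e e' lt_e' w w'.
  exact: (h2 i lt_i e lt_e e' lt_e' (b _ _ lt_i lt_e w) (b _ _ lt_i lt_e' w')).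
split.
  move=> i lt_i j lt_j e lt_e w w'.
  exact: (h3 i lt_i j lt_j e lt_e (b _ _ lt_i lt_e w) (b _ _ lt_j lt_e w')).
split.
  move=> i lt_i j lt_j e lt_e e' lt_e' w w'.
  exact: (h4 i lt_i j lt_j e lt_e e' lt_e' (b _ _ lt_i lt_e w) (b _ _ lt_j lt_e' w')).
split.
  move=> i lt_i e lt_e e' lt_e' w lt.
  have [j [lt_j wj]] := h5 i lt_i e lt_e e' lt_e' (b _ _ lt_i lt_e w) lt.
  by exists j; split=> //; apply: f.
split.
  move=> i lt_i j lt_j e lt_e e' lt_e' w w'.
  exact: (h6 i lt_i j lt_j e lt_e e' lt_e' (b _ _ lt_i lt_e w) (b _ _ lt_j lt_e' w')).
move=> e lt_e; case: (h7 e lt_e) => [[i [lt_i w]]|[i [lt_i [e' [lt_e' [w ce]]]]]]; [left|right].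
  by exists i; split=> //; apply: f.
by exists i; split=> //; exists e'; split=> //; split=> //; apply: f.
Qed.

Lemma traces_traceF t : traces E t <->
  traceF tk o n l c (W t) (size t) /\ (forall i, i < size t -> nth 0 t i < n).
Proof.
split.
  case=> C [/(max_conf_conflict hE)[[rng down free] dom] [ut mt ord]].
  have ltn_t i : i < size t -> nth 0 t i < n by move=> lt_i; apply: rng; apply/mt; apply: mem_nth.
  split=> //; split; first by move=> i lt_i; exists (nth 0 t i); split; [apply: ltn_t|].
  split; first by move=> i lt_i e _ e' _ [_ <-] [_ <-].
  split; first by move=> i lt_i j lt_j e _ [_ <-] [_ /eqP]; rewrite nth_uniq // => /eqP->.
  split.
    move=> i lt_i j lt_j e lt_e e' lt_e' [_ ei] [_ ej] /ltFE l12; apply: ord => //.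
    by rewrite ei ej; apply: l12; apply: lea.
  split.
    move=> i lt_i e lt_e e' lt_e' [_ ei] /ltFE l12.
    have : e' \in t.
      apply/mt; apply: (down e); last by apply: l12; apply: lea.
      by apply/mt; rewrite -ei mem_nth.
    by move=> /(nthP 0)[j lt_j ej]; exists j.
  split.
    move=> i lt_i j lt_j e lt_e e' lt_e' [_ ei] [_ ej] /cfFE c12.
    have := free e e'; rewrite c12; [|exact: lea|exact: lea].
    by move=> h; have := h _ _; rewrite -!mt -ei -ej !mem_nth // => /(_ isT isT).
  move=> e lt_e; have [/(nthP 0)[i lt_i ei]|ne] := boolP (e \in t); first by left; exists i.
  right; have [|d [dC cde]] := dom e lt_e.
    by apply/negP => /mt; apply/negP.
  have /mt/(nthP 0)[i lt_i ei] := dC; exists i; split=> //; exists d.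
  have lt_d : d < n by apply: rng.
  by split=> //; split=> //; apply/cfFE => //; apply: lea.
case=> [[_ [_ [h3 [h4 [h5 [h6 h7]]]]]] ltn_t].
have memT e : e \in t -> exists2 i, i < size t & W t i e.
  by move=> /(nthP 0)[i lt_i ei]; exists i.
have rng e : e \in t -> e < n by move=> /memT[i lt_i [_ <-]]; apply: ltn_t.
(* A configuration may be any list with the right members, so the trace itself serves. *)
exists t; split; last first.
  split=> //.
    apply/(uniqP 0) => i j lt_i lt_j eij.
    by apply: (h3 i lt_i j lt_j (nth 0 t i) (ltn_t i lt_i)) => //; split.
  move=> i j lt_i lt_j lt_ij.
  apply: (h4 i lt_i j lt_j (nth 0 t i) (ltn_t i lt_i) (nth 0 t j) (ltn_t j lt_j)) => //.
  by apply/ltFE => //; apply: lea; apply: ltn_t.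
apply/(max_conf_conflict hE); split.
  split=> // e e' te.
    move=> lt'; have [[rl _] lt_e] := (let: And5 _ r _ _ _ := hE in r, rng _ te).
    have [lt_e' _] := rl _ _ lt'; have [i lt_i w] := memT _ te.
    have lf : ltF tk o l e' e by apply/ltFE => //; apply: lea.
    by have [j [lt_j [_ <-]]] := h5 i lt_i e lt_e e' lt_e' w lf; apply: mem_nth.
  move=> te'; apply/negP => ce; have [[i lt_i w] [j lt_j w']] := (memT _ te, memT _ te').
  apply: (h6 i lt_i j lt_j e (rng _ te) e' (rng _ te') w w').
  by apply/cfFE => //; apply: lea; apply: rng.
move=> e lt_e ne; case: (h7 e lt_e) => [[i [lt_i [_ ei]]]|[i [lt_i [e' [lt_e' [[_ ei] ce]]]]]].
  by move: ne; rewrite -ei mem_nth.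
exists e'; split; first by rewrite -ei mem_nth.
by apply/cfFE; [| |exact: ce]; apply: lea.
Qed.

Lemma traceF_list (V : nat -> nat -> Prop) m : traceF tk o n l c V m -> exists t,
  [/\ size t = m, traces E t & forall i e, i < m -> e < n -> V i e <-> nth 0 t i = e].
Proof.
move=> h; have [h1 [h2 _]] := h.
have [t et vt] : exists2 t, size t = m & forall i, i < m -> nth 0 t i < n /\ V i (nth 0 t i).
  have : forall i, i < m -> exists e, e < n /\ V i e by [].
  elim: m {h h1 h2} => [|m IH] h; first by exists [::].
  have [i lt_i|t et vt] := IH; first by apply: h; apply: ltnW.
  have [e [lt_e ve]] := h m (ltnSn m); exists (rcons t e); first by rewrite size_rcons et.
  move=> i; rewrite ltnS leq_eqVlt nth_rcons et => /orP[/eqP->|lt_i].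
    by rewrite ltnn eqxx.
  by rewrite lt_i; apply: vt.
have vE i e : i < m -> e < n -> V i e <-> nth 0 t i = e.
  move=> lt_i lt_e; have [lt' v'] := vt i lt_i; split=> [v|<-] //.
  exact: (h2 i lt_i).
exists t; split=> //; apply/traces_traceF; split; last by move=> i; rewrite et => /vt[].
rewrite et; apply: traceF_ext h => i e lt_i lt_e; rewrite vE // /W et.
by split=> [->|[]].
Qed.

Lemma visibleFE V t : (forall i e, i < size t -> e < n -> V i e <-> nth 0 t i = e) ->
  (forall i, i < size t -> nth 0 t i < n) ->
  forall i, i < size t -> visibleF tk o n l c V i <-> lab E (nth 0 t i) != eps.
Proof.
move=> vE rng i lt_i; split.
  by case=> e [lt_e [/vE -> //]]; rewrite epsFE // => /eqP.
by move=> ne; exists (nth 0 t i); split; [|split; [apply/vE|rewrite epsFE; [apply/eqP|]]]; rewrite ?rng.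
Qed.

End Traces.
End FlesSemantics.

Lemma hword_iota E t : hword E t = [seq b <- map (fun i => lab E (nth 0 t i)) (iota 0 (size t)) | b != eps].
Proof. by rewrite /hword (map_comp (lab E) (nth 0 t)) -/(mkseq _ _) mkseq_nth. Qed.

(** * The verifier *)

(* [A] and [W] are the two traces, [B] matches their visible positions; the
   clause on [m1] prevents a proper prefix of [A] from being taken for the
   trace. *)
Definition incl_formula (a : nat) (X : nat -> bool) (A P V Q W B : nat -> nat -> bool) : Prop :=
  exists h, h <= a /\ (a = h + h /\
  pairs_wf h X /\ count_wf a h X P /\ value_wf a h X V /\ equal_wf h X Q /\
  exists n1, n1 <= a /\ exists l1, l1 <= a /\ exists c1, c1 <= a /\ exists o, o <= a /\
  exists n2, n2 <= a /\ exists l2, l2 <= a /\ exists c2, c2 <= a /\ exists s, s <= a /\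
  (o = 4 + (l1 + l1) + (c1 + c1) + n1 /\ s = o + 4 + (l2 + l2) + (c2 + c2) + n2 /\ P s h /\
   let tk := tok h X P V in
   headF tk 0 n1 l1 c1 /\ headF tk o n2 l2 c2 /\ wfF tk 0 n1 l1 c1 /\ wfF tk o n2 l2 c2 /\
   forall m1, m1 <= n1 -> traceF tk 0 n1 l1 c1 A m1 ->
     (forall i, i <= a -> (exists e, e < n1 /\ A i e) -> i < m1) ->
     exists m2, m2 <= n2 /\ (traceF tk o n2 l2 c2 W m2 /\
       matchF (visibleF tk 0 n1 l1 c1 A) (visibleF tk o n2 l2 c2 W)
         (fun i j => forall e, e < n1 -> A i e -> forall e', e' < n2 -> W j e' ->
            teq h X P Q (0 + 4 + (l1 + l1) + (c1 + c1) + e) (o + 4 + (l2 + l2) + (c2 + c2) + e'))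
         B m1 m2))).

(* A bit string holds binary relations over [0, M), laid out one after the
   other. *)
Definition rel_bit M y j p c : bool := nth false y ((j * M + p) * M + c).

Definition realize M J (S : nat -> nat -> nat -> bool) : seq bool :=
  mkseq (fun u => S (u %/ M %/ M) (u %/ M %% M) (u %% M)) (J * M * M).

Lemma rel_bit_realize M J S j p c : j < J -> p < M -> c < M -> rel_bit M (realize M J S) j p c = S j p c.
Proof.
move=> lt_j lt_p lt_c; have gt0 : 0 < M by lia.
rewrite /rel_bit nth_mkseq; last by nia.
rewrite divnMDl // (divn_small lt_c) addn0 divnMDl // (divn_small lt_p) addn0.
by rewrite !modnMDl (modn_small lt_c) (modn_small lt_p).
Qed.

(** The relations are read directly off [tup3 x y1 y2], where [x] and [y1] are doubled and [y2] is
    not. The guards by [a] and [b] keep reads from running into the next component; past the end of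
    [y2] bits are false by default. *)
Definition incl_formula_at z a b : Prop :=
  let M := a.+1 in
  incl_formula a (fun i => (i < a) && nth false z (i + i))
    (fun p c => ((0 * M + p) * M + c < b) &&
       nth false z (a + a + 2 + (((0 * M + p) * M + c) + ((0 * M + p) * M + c))))
    (fun p c => nth false z (a + a + 2 + (b + b) + 2 + ((0 * M + p) * M + c)))
    (fun p c => nth false z (a + a + 2 + (b + b) + 2 + ((1 * M + p) * M + c)))
    (fun p c => nth false z (a + a + 2 + (b + b) + 2 + ((2 * M + p) * M + c)))
    (fun p c => nth false z (a + a + 2 + (b + b) + 2 + ((3 * M + p) * M + c)))
    (fun p c => nth false z (a + a + 2 + (b + b) + 2 + ((4 * M + p) * M + c))).

(** On a tuple, [a] and [b] are forced to be the lengths of the first two components, as positions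
    of the first separators. *)
Definition checker z : Prop :=
  exists a, a <= size z /\ exists b, b <= size z /\
  (((~ nth false z (a + a) /\ ~ nth false z (a + a).+1) /\
    (forall i, i < a -> nth false z (i + i).+1)) /\
   ((~ nth false z (a + a + 2 + (b + b)) /\ ~ nth false z (a + a + 2 + (b + b)).+1) /\
    (forall i, i < b -> nth false z (a + a + 2 + (i + i)).+1)) /\
   incl_formula_at z a b).

Lemma definable_checker : definable (fun z _ => checker z).
Proof.
rewrite /checker /incl_formula_at /incl_formula /headF /wfF /traceF /rangeF /ltF /cfF /matchF /visibleF /epsF
  /pairs_wf /count_wf /value_wf /equal_wf /teq /tok /start.
define.
Qed.

Lemma nth_dbl x s i : i < size x ->
  nth false (dbl x ++ s) (i + i) = nth false x i /\ nth false (dbl x ++ s) (i + i).+1.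
Proof. by elim: x i => //= b x IH [|i] //= lt_i; rewrite addnS /=; apply: IH. Qed.

Lemma size_dbl x : size (dbl x) = size x + size x.
Proof. by elim: x => //= b x; rewrite /dbl => ->; rewrite addnS. Qed.

Lemma nth_after x s i : nth false (dbl x ++ [:: false; false] ++ s) (size x + size x + 2 + i) =
  nth false s i.
Proof. by rewrite -size_dbl -addnA nth_catr. Qed.

Lemma separator_unique (f : nat -> bool) a b : ~ f (a + a).+1 -> ~ f (b + b).+1 ->
  (forall i, i < a -> f (i + i).+1) -> (forall i, i < b -> f (i + i).+1) -> a = b.
Proof.
by move=> na nb ha hb; case: (ltngtP a b) => // [/hb|/ha].
Qed.

Lemma incl_formula_at_tup3 x y1 y2 : incl_formula_at (tup3 x y1 y2) (size x) (size y1) =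
  incl_formula (size x) (nth false x) (rel_bit (size x).+1 y1 0) (rel_bit (size x).+1 y2 0)
    (rel_bit (size x).+1 y2 1) (rel_bit (size x).+1 y2 2) (rel_bit (size x).+1 y2 3) (rel_bit (size x).+1 y2 4).
Proof.
rewrite /incl_formula_at; set z := tup3 x y1 y2.
have e1 : (fun i => (i < size x) && nth false z (i + i)) = nth false x.
  apply: functional_extensionality => i; case: ltnP => le_i /=.
    by rewrite /z /tup3; case: (nth_dbl ([:: false; false] ++ dbl y1 ++ [:: false; false] ++ y2) le_i).
  by rewrite nth_default.
have e2 i : nth false z (size x + size x + 2 + (i + i)) =
    nth false (dbl y1 ++ [:: false; false] ++ y2) (i + i) by rewrite /z /tup3 nth_after.
have e3 i : nth false z (size x + size x + 2 + (size y1 + size y1) + 2 + i) = nth false y2 i.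
  rewrite (_ : _ + i = size x + size x + 2 + (size y1 + size y1 + 2 + i)); last by lia.
  by rewrite /z /tup3 !nth_after.
congr incl_formula; first exact: e1.
all: apply: functional_extensionality => p; apply: functional_extensionality => c.
  rewrite e2 /rel_bit; case: ltnP => le_i /=; last by rewrite nth_default.
  by case: (nth_dbl ([:: false; false] ++ y2) le_i).
all: by rewrite e3.
Qed.

Lemma checker_tup3 x y1 y2 : checker (tup3 x y1 y2) <->
  incl_formula (size x) (nth false x) (rel_bit (size x).+1 y1 0) (rel_bit (size x).+1 y2 0)
    (rel_bit (size x).+1 y2 1) (rel_bit (size x).+1 y2 2) (rel_bit (size x).+1 y2 3) (rel_bit (size x).+1 y2 4).
Proof.
rewrite -incl_formula_at_tup3; set z := tup3 x y1 y2.
have x1 i : i < size x -> nth false z (i + i).+1 by move=> lt_i;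
    case: (nth_dbl ([:: false; false] ++ dbl y1 ++ [:: false; false] ++ y2) lt_i).
have xe i : i < 2 -> nth false z (size x + size x + i) = false.
  by rewrite /z /tup3 -size_dbl nth_catr; case: i => [|[]].
have y1' i : i < size y1 -> nth false z (size x + size x + 2 + (i + i)).+1.
  by move=> lt_i; rewrite /z /tup3 -addnS nth_after; case: (nth_dbl ([:: false; false] ++ y2) lt_i).
have ye i : i < 2 -> nth false z (size x + size x + 2 + (size y1 + size y1 + i)) = false.
  by rewrite /z /tup3 nth_after -size_dbl nth_catr; case: i => [|[]].
have x0 := xe 0 isT; have x0' := xe 1 isT; have y0 := ye 0 isT; have y0' := ye 1 isT.
rewrite !addn0 in x0 y0; rewrite !addn1 in x0'; rewrite !addn1 addnS in y0'.
split=> [[a [_ [b [_ [[[_ na] ha] [[[_ nb] hb] hp]]]]]]|hp].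
  have ea : a = size x.
    by apply: (separator_unique (f := nth false z)) => //; rewrite x0'.
  subst a; have eb : b = size y1.
    apply: (separator_unique (f := fun i => nth false z (size x + size x + 2 + i))).
    - by rewrite addnS.
    - by rewrite addnS y0'.
    - by move=> i lt_i; rewrite addnS; apply: hb.
    - by move=> i lt_i; rewrite addnS; apply: y1'.
  by subst b.
have sz : size x <= size z /\ size y1 <= size z.
  by rewrite /z /tup3 !size_cat !size_dbl; lia.
exists (size x); split; first by case: sz.
exists (size y1); split; first by case: sz.
by rewrite x0 x0' y0 y0'.
Qed.

Lemma headF_reads tk ts o n l c E a : headF tk o n l c -> reads ts o E ->
  (forall k v, k < size ts -> v <= a -> tk k v -> nth 0 ts k = v) ->
  o + 4 + (l + l) + (c + c) + n <= size ts -> n <= a -> l <= a -> c <= a ->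
  [/\ n = fl_n E, l = size (fl_lt E) & c = size (fl_cf E)].
Proof.
move=> [h1 [h2 [h3 h4]]] [[r1 r2 r3 r4] _ _ _] htk le_s le_n le_l le_c.
have e1 : n = fl_n E by rewrite -r1 (htk o n) //; lia.
have e2 : l = size (fl_lt E) by rewrite -r2 (htk (o + 1) l) //; lia.
split=> //; rewrite -r3 -e2 (htk (o + 2 + (l + l)) c) //; lia.
Qed.

(** * Soundness of the verifier *)

Section Sound.
Variables (x : seq bool) (A P V Q W B : nat -> nat -> bool).
Let a := size x.
Let ts := toks x.
Hypothesis hphi : incl_formula a (nth false x) A P V Q W B.

Lemma incl_formula_decode : exists E1 E2,
  [/\ x = enc_fles E1 ++ enc_fles E2, size (fl_lab E1) = fl_n E1 & size (fl_lab E2) = fl_n E2].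
Proof.
have [h [le_h [ea [hX [hP [hV [hQ [n1 [le_n1 [l1 [le_l1 [c1 [le_c1 [o [le_o [n2 [le_n2
  [l2 [le_l2 [c2 [le_c2 [s [le_s [eo [es [Ps [h1 [h2 _]]]]]]]]]]]]]]]]]]]]]]]]]]]] := hphi.
have htk k v : k <= a -> v <= a -> tok h (nth false x) P V k v -> nth 0 ts k = v.
  by move=> le_k le_v /(tokP ea hX hP hV le_k le_v)[].
have ess : s = size ts by apply/(totalP ea hX hP le_s).
have [t1 [t2 [t3 t4]]] := h1; have [u1 [u2 [u3 u4]]] := h2.
have [|||||E1 [en1 el1 ec1 eb1 d1]] := @drop_fles ts 0 n1 l1 c1.
1-5: by [lia | apply: htk => //; lia].
have [|||||E2 [en2 el2 ec2 eb2 d2]] := @drop_fles ts o n2 l2 c2.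
1-5: by [lia | apply: htk => //; lia].
exists E1, E2; split; [|by rewrite eb1 en1|by rewrite eb2 en2].
have [ex _ _] : [/\ flatten (map enc_nat (toks x)) = x, (0 < size x) = (0 < size (toks x)) &
      (0 < head 0 (toks x)) = nth false x 1] by apply: enc_toks; exists h.
rewrite !enc_fles_toks -flatten_cat -map_cat -{1}ex; congr (flatten (map _ _)).
(* The table [P] certifies exactly [s] tokens in all, so nothing follows the second structure. *)
move: d1; rewrite drop0 -/ts add0n -eo d2 => ->.
by rewrite -es ess drop_size cats0.
Qed.

Lemma incl_formula_incl E1 E2 t1 : x = enc_fles E1 ++ enc_fles E2 ->
  size (fl_lab E1) = fl_n E1 -> size (fl_lab E2) = fl_n E2 ->
  (forall i e, i <= a -> e <= a -> A i e = (i < size t1) && (nth 0 t1 i == e)) ->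
  [/\ wf_fles E1, wf_fles E2 & traces E1 t1 -> exists2 t2, traces E2 t2 & hword E1 t1 = hword E2 t2].
Proof.
move=> ex lab1 lab2 hA.
have [h [le_h [ea [hX [hP [hV [hQ [n1 [le_n1 [l1 [le_l1 [c1 [le_c1 [o [le_o [n2 [le_n2
  [l2 [le_l2 [c2 [le_c2 [s [le_s [eo [es [Ps [h1 [h2 [w1 [w2 main]]]]]]]]]]]]]]]]]]]]]]]]]]]]]] := hphi.
set tk := tok h (nth false x) P V in h1 h2 w1 w2 main.
have ets : ts = fles_toks E1 ++ fles_toks E2.
  by rewrite /ts ex !enc_fles_toks -flatten_cat -map_cat toks_enc.
have ess : s = size ts by apply/(totalP ea hX hP le_s).
have htk k v : k < size ts -> v <= a -> tk k v <-> nth 0 ts k = v.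
  move=> lt_k le_v; have le_k : k <= a by lia.
  by rewrite /tk (tokP ea hX hP hV le_k le_v); split=> [[]|].
have htk' k v : k < size ts -> v <= a -> tk k v -> nth 0 ts k = v.
  by move=> lt_k le_v; case: (htk k v lt_k le_v).
have r1 : reads ts 0 E1 by have := reads_toks [::] E1 (fles_toks E2); rewrite -ets.
have [e1 e2 e3] : [/\ n1 = fl_n E1, l1 = size (fl_lt E1) & c1 = size (fl_cf E1)].
  by apply: (headF_reads h1 r1 htk') => //; lia.
have sz1 : size (fles_toks E1) = o by rewrite size_fles_toks lab1 -e1 -e2 -e3 eo.
have r2 : reads ts o E2.
  by have := reads_toks (fles_toks E1) E2 [::]; rewrite cats0 -ets sz1.
have [f1 f2 f3] : [/\ n2 = fl_n E2, l2 = size (fl_lt E2) & c2 = size (fl_cf E2)].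
  by apply: (headF_reads h2 r2 htk') => //; lia.
have sz2 : o + size (fles_toks E2) = s.
  by rewrite size_fles_toks lab2 -f1 -f2 -f3 es !addnA.
subst n1 l1 c1 n2 l2 c2.
have tk1 k v : k < 0 + size (fles_toks E1) -> v <= a -> tk k v <-> nth 0 ts k = v.
  by move=> lt_k; apply: htk; lia.
have tk2 k v : k < o + size (fles_toks E2) -> v <= a -> tk k v <-> nth 0 ts k = v.
  by move=> lt_k; apply: htk; lia.
have wf1 : wf_fles E1 by apply/(wfFE lab1 le_n1 r1 tk1).
have wf2 : wf_fles E2 by apply/(wfFE lab2 le_n2 r2 tk2).
split=> // tr1.
have [T1 rng1] := (traces_traceF lab1 le_n1 r1 tk1 wf1 t1).1 tr1.
have sz_t1 := traces_size tr1.
have A1 i e : i < size t1 -> e < fl_n E1 -> A i e <-> nth 0 t1 i = e.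
  by move=> lt_i lt_e; rewrite hA ?lt_i /=; lia.
(* The length is instantiated by [size t1], past which [A] has no entries. *)
have [|i le_i [e [lt_e]]|m2 [le_m2 [T2 mt]]] := main (size t1) sz_t1.
- apply: traceF_ext T1 => i e lt_i lt_e; rewrite A1 //.
  by split=> [[]|].
- by rewrite hA //; [case/andP | lia].
have [t2 [et2 tr2 W2]] := traceF_list lab2 le_n2 r2 tk2 wf2 T2.
exists t2 => //; have [_ rng2] := (traces_traceF lab2 le_n2 r2 tk2 wf2 t2).1 tr2.
subst m2; rewrite !hword_iota; apply: (@matchF_words _ _ _ _ B).
have vis1 := visibleFE lab1 le_n1 r1 tk1 A1 rng1.
have vis2 := visibleFE lab2 le_n2 r2 tk2 W2 rng2.
case: mt => m1 [m2 [m3 m4]]; split.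
  by move=> i lt_i /(vis1 i lt_i); apply: m1.
split.
  by move=> i lt_i /(vis2 i lt_i); apply: m2.
split=> // i lt_i j lt_j Bij; have [/(vis1 i lt_i) v1 [/(vis2 j lt_j) v2 sm]] := m3 i lt_i j lt_j Bij.
split=> //; split=> //.
have {}sm := sm _ (rng1 i lt_i) ((A1 _ _ lt_i (rng1 i lt_i)).2 erefl) _ (rng2 j lt_j)
  ((W2 _ _ lt_j (rng2 j lt_j)).2 erefl).
have [ri rj] := (rng1 i lt_i, rng2 j lt_j).
move: sm; rewrite (teqP ea hX hP hQ); last 2 first.
- by rewrite -/ts; lia.
- by rewrite -/ts; lia.
have [_ _ _ q1] := r1; have [_ _ _ q2] := r2.
by rewrite -/ts q1 ?lab1 // q2 ?lab2.
Qed.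

End Sound.

(** [A] comes from the opponent and is arbitrary. The actual tables [R] agree with the intended ones
    [S] only on arguments up to [size x], since a bit string realizes no more. *)
Lemma incl_formula_complete E1 E2 (A : nat -> nat -> bool) (x := enc_fles E1 ++ enc_fles E2) :
  wf_fles E1 -> wf_fles E2 -> (forall w, lang E1 w -> lang E2 w) ->
  exists S : nat -> nat -> nat -> bool, forall R : nat -> nat -> nat -> bool,
    (forall j p c, j < 5 -> p <= size x -> c <= size x -> R j p c = S j p c) ->
    incl_formula (size x) (nth false x) A (R 0) (R 1) (R 2) (R 3) (R 4).
Proof.
move=> wf1 wf2 incl; pose ts := toks x; pose a := size x.
have [lab1 _ _ _ _] := wf1; have [lab2 _ _ _ _] := wf2.
have ets : ts = fles_toks E1 ++ fles_toks E2.
  by rewrite /ts /x !enc_fles_toks -flatten_cat -map_cat toks_enc.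
have [h ea hX] : pairs_ok x.
  by rewrite /x !enc_fles_toks -flatten_cat -map_cat; apply: pairs_ok_enc.
pose val i := head 0 (toks (drop (i + i) x)).
pose P k i := k == seps x i.
pose V i v := v == val i.
pose Q i j := val i == val j.
pose l1 := size (fl_lt E1); pose c1 := size (fl_cf E1).
pose l2 := size (fl_lt E2); pose c2 := size (fl_cf E2).
pose o := 4 + (l1 + l1) + (c1 + c1) + fl_n E1.
pose s := o + 4 + (l2 + l2) + (c2 + c2) + fl_n E2.
have sz1 : size (fles_toks E1) = o by rewrite size_fles_toks lab1.
have sz2 : o + size (fles_toks E2) = s.
  by rewrite size_fles_toks lab2 /s /l2 /c2; lia.
have szt : size ts = s by rewrite ets size_cat sz1 sz2.
have le_s : s <= a by rewrite -szt; apply: size_ts_le ea hX.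
have r1 : reads ts 0 E1 by have := reads_toks [::] E1 (fles_toks E2); rewrite -ets.
have r2 : reads ts o E2.
  by have := reads_toks (fles_toks E1) E2 [::]; rewrite cats0 -ets sz1.
have [le_n1 le_l1 le_c1 le_o] : [/\ fl_n E1 <= a, l1 <= a, c1 <= a & o <= a].
  by move: le_s; rewrite /s /o; split; lia.
have [le_n2 le_l2 le_c2] : [/\ fl_n E2 <= a, l2 <= a & c2 <= a].
  by move: le_s; rewrite /s; split; lia.
pose tk := tok h (nth false x) P V.
pose good m1 t1 t2 := [/\ size t1 = m1, traces E1 t1, traces E2 t2, hword E1 t1 = hword E2 t2 &
  forall i e, i < m1 -> e < fl_n E1 -> A i e <-> nth 0 t1 i = e].
pose run tk m1 := [/\ m1 <= fl_n E1, traceF tk 0 (fl_n E1) l1 c1 A m1 &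
  forall i, i <= a -> (exists e, e < fl_n E1 /\ A i e) -> i < m1].
have tokE P' V' : count_wf a h (nth false x) P' -> value_wf a h (nth false x) V' ->
    forall k v, k < s -> v <= a -> tok h (nth false x) P' V' k v <-> nth 0 ts k = v.
  move=> hP hV k v lt_k le_v; rewrite (tokP ea hX hP hV) //; last by rewrite -/a; lia.
  by rewrite -/ts szt lt_k; split=> [[]|].
(* [S] contains the tables of [t2] and of the matching, so both traces are chosen before the actual
   tables are known; hence the quantification over all admissible [P'] and [V']. *)
have [t1 [t2 ht]] : exists t1 t2, forall P' V' m1,
    count_wf a h (nth false x) P' -> value_wf a h (nth false x) V' ->
    run (tok h (nth false x) P' V') m1 -> good m1 t1 t2.
  pose some := exists P' V' m1, [/\ count_wf a h (nth false x) P',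
    value_wf a h (nth false x) V' & run (tok h (nth false x) P' V') m1].
  (* If [A] codes no trace, the claim is vacuous and any lists will do. *)
  have [|none] := classic some; last first.
    by exists [::], [::] => P' V' m1 hP hV hr; case: none; exists P', V', m1.
  case=> P0 [V0 [m0 [hP0 hV0 [le_m0 T0 max0]]]].
  have tk1 k v : k < 0 + size (fles_toks E1) -> v <= a ->
      tok h (nth false x) P0 V0 k v <-> nth 0 ts k = v.
    by move=> lt_k; apply: tokE => //; rewrite add0n in lt_k; lia.
  have [t1 [et1 tr1 At1]] := traceF_list lab1 le_n1 r1 tk1 wf1 T0.
  have [t2 [tr2 ew]] : lang E2 (hword E1 t1) by apply: incl; exists t1.
  exists t1, t2 => P' V' m1 _ _ [le_m1 [tot1 _] max1].
  (* If the lengths differed, the position numbered by the smaller one would hold an event, against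
     the clause that bounds the positions of that run. *)
  have em : m1 = m0.
    have [tot0 _] := T0; case: (ltngtP m1 m0) => // lt_m.
      by have := max1 m1 (leq_trans le_m1 le_n1) (tot0 _ lt_m); rewrite ltnn.
    by have := max0 m0 (leq_trans le_m0 le_n1) (tot1 _ lt_m); rewrite ltnn.
  by subst m1.
pose f1 i := lab E1 (nth 0 t1 i); pose f2 i := lab E2 (nth 0 t2 i).
pose idx (m : nat) (f : nat -> nat) := [seq i <- iota 0 m | f i != eps].
pose B i j := [&& f1 i != eps, f2 j != eps &
  index i (idx (size t1) f1) == index j (idx (size t2) f2)].
pose W i e := (i < size t2) && (nth 0 t2 i == e).
exists (fun j => nth (fun _ _ => false) [:: P; V; Q; W; B] j) => R hR.
have [hP hV hQ] : [/\ count_wf a h (nth false x) (R 0), value_wf a h (nth false x) (R 1) &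
    equal_wf h (nth false x) (R 2)].
  split.
  - by apply: count_wf_guess => // k i le_k le_i; rewrite hR.
  - by apply: value_wf_guess => // k i le_k le_i; rewrite hR.
  - by apply: equal_wf_guess => // k i le_k le_i; rewrite hR.
have tk1 k v : k < 0 + size (fles_toks E1) -> v <= a ->
    tok h (nth false x) (R 0) (R 1) k v <-> nth 0 ts k = v.
  by move=> lt_k; apply: tokE => //; rewrite add0n in lt_k; lia.
have tk2 k v : k < o + size (fles_toks E2) -> v <= a ->
    tok h (nth false x) (R 0) (R 1) k v <-> nth 0 ts k = v.
  by move=> lt_k; apply: tokE => //; lia.
exists h; split; first by rewrite ea leq_addr.
do 5 split=> //.
exists (fl_n E1); split=> //; exists l1; split=> //; exists c1; split=> //; exists o; split=> //.
exists (fl_n E2); split=> //; exists l2; split=> //; exists c2; split=> //; exists s; split=> //.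
do 2 split=> //.
split; first by apply/(totalP ea hX hP le_s); rewrite -szt.
split; first exact: (headFE lab1 le_n1 r1 tk1).
split; first exact: (headFE lab2 le_n2 r2 tk2).
split; first exact/(wfFE lab1 le_n1 r1 tk1).
split; first exact/(wfFE lab2 le_n2 r2 tk2).
move=> m1 le_m1 T1 max1.
have [et1 tr1 tr2 ew A1] : good m1 t1 t2 by apply: (ht _ _ _ hP hV).
subst m1; exists (size t2); have le_t2 := traces_size tr2; split=> //.
have [_ rng1] := (traces_traceF lab1 le_n1 r1 tk1 wf1 t1).1 tr1.
have [T2 rng2] := (traces_traceF lab2 le_n2 r2 tk2 wf2 t2).1 tr2.
have W2 i e : i < size t2 -> e < fl_n E2 -> R 3 i e <-> nth 0 t2 i = e.
  by move=> lt_i lt_e; rewrite hR //= ?/W ?lt_i /=; rewrite -/a; lia.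
split.
  by apply: traceF_ext T2 => i e lt_i lt_e; rewrite W2 //; split=> [[]|].
have vis1 := visibleFE lab1 le_n1 r1 tk1 A1 rng1.
have vis2 := visibleFE lab2 le_n2 r2 tk2 W2 rng2.
have [m1 [m2 [m3 m4]]] : matchF (fun i => f1 i != eps) (fun j => f2 j != eps)
    (fun i j => f1 i = f2 j) (R 4) (size t1) (size t2).
  apply: words_matchF; first by move: ew; rewrite !hword_iota.
  by move=> i j lt_i lt_j; rewrite hR //; rewrite -/a; lia.
split; first by move=> i lt_i /(vis1 i lt_i); apply: m1.
split; first by move=> i lt_i /(vis2 i lt_i); apply: m2.
split=> // i lt_i j lt_j Bij; have [v1 [v2 sm]] := m3 i lt_i j lt_j Bij.
split; first exact/(vis1 i lt_i).
split; first exact/(vis2 j lt_j).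
move=> e lt_e /(A1 i e lt_i lt_e) <- e' lt_e' /(W2 j e' lt_j lt_e') <-.
have [ri rj] := (rng1 i lt_i, rng2 j lt_j).
apply/(teqP ea hX hP hQ); rewrite -/ts.
- by lia.
- by lia.
- have [_ _ _ q1] := r1; have [_ _ _ q2] := r2.
  by rewrite q1 ?lab1 // q2 ?lab2.
Qed.

Theorem theorem3 : in_Pi2 FLES_INCL.
Proof.
(* [y2] holds five relations on n + 1 points with n = [size x], and 5 * (n + 1)^2 is at most 20 *
   n^2 + 20. *)
exists checker, 20, 2; split.
  exact: (in_P_definable definable_checker).
move=> x; set bound := 20 * _ + 20.
have le_bound J (S : nat -> nat -> nat -> bool) : J <= 5 ->
    size (realize (size x).+1 J S) <= bound.
  rewrite size_mkseq /bound => le_J; move: (size x) => n.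
  apply: (@leq_trans (5 * n.+1 * n.+1)); first by rewrite !leq_mul2r le_J !orbT.
  by rewrite -mulnn; nia.
split.
  case=> E1 [E2 [wf1 wf2 ex incl]] y1 _.
  have [S hS] := incl_formula_complete (rel_bit (size x).+1 y1 0) wf1 wf2 incl.
  exists (realize (size x).+1 5 S); split; first exact: le_bound.
  apply/checker_tup3; rewrite -ex in hS.
  by apply: (hS (rel_bit (size x).+1 (realize (size x).+1 5 S))) => *; apply: rel_bit_realize.
move=> hy.
(* Any [y1], here the empty one, already shows that [x] encodes two structures; they are fixed
   before the trace varies. *)
have [y2 [_ /checker_tup3 /incl_formula_decode[E1 [E2 [ex lab1 lab2]]]]] := hy [::] isT.
have key t1 : [/\ wf_fles E1, wf_fles E2 &
    traces E1 t1 -> exists2 t2, traces E2 t2 & hword E1 t1 = hword E2 t2].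
  (* The universal quantifier is instantiated by the table of [t1]. *)
  pose S (j i e : nat) := (i < size t1) && (nth 0 t1 i == e).
  have [y3 [_ /checker_tup3 hphi]] := hy (realize (size x).+1 1 S) (le_bound 1 S isT).
  apply: (incl_formula_incl hphi ex lab1 lab2) => i e le_i le_e.
  exact: rel_bit_realize.
have [wf1 wf2 _] := key [::]; exists E1, E2; split=> // w [t1 [tr1 ->]].
have [_ _ /(_ tr1)[t2 tr2 ->]] := key t1.
by exists t2.
Qed.
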